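(* Consider a family of multiclass queueing networks indexed by $r\in(0,1]$ under a preemptive-resume static-buffer-priority discipline as described in the context, satisfying the moment, heavy-traffic, stability and state-space-collapse assumptions (A1)--(A4) of the context. Let $\mathbb P_{e,k}$, $\mathbb P_{s,k}$ be the Palm distributions of the $r$th network and $Z_-^{(r)}$ the pre-jump job-count vector. Then for every high-priority class $\ell\in\mathcal H$, as $r\to0$, $$\mathbb P_{e,k}\{Z^{(r)}_{-,\ell}>r^{-1}-1\}=o(r),\quad k\in\mathcal E,\qquad\qquad \mathbb P_{s,k}\{Z^{(r)}_{-,\ell}>r^{-1}-1\}=o(r),\quad k\in\mathcal K.$$
   Context: **Network.** There are $J$ single-server stations with unlimited waiting space and $K>J$ job classes $\mathcal K=\{1,\dots,K\}$; class $k$ is served at station $s(k)$. $\mathcal E\subset\mathcal K$ is the set of classes with external arrivals. External inter-arrival times to class $k\in\mathcal E$ are $a_kT_{e,k}(i)$, $i\ge1$, with $a_k=1/\lambda_k$, $\lambda_k>0$ ($\lambda_k=0$ for $k\notin\mathcal E$); the $i$th class $k$ service time is $m_kT_{s,k}(i)$, $m_k>0$; the job completing the $i$th class $k$ service becomes a class $\ell$ job if $\Phi^{(k)}(i)=e^{(\ell)}$ (the $\ell$th unit vector of $\mathbb R^K$) and leaves if $\Phi^{(k)}(i)=e^{(0)}=0$. All sequences are i.i.d. and mutually independent with generic elements $T_{e,k},T_{s,k}\ge0$ of mean one, and $\Phi^{(k)}$. $P_{k\ell}=\mathbb P\{\Phi^{(k)}=e^{(\ell)}\}$, $I-P$ invertible.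 $\alpha=(I-P^T)^{-1}\lambda$ (with $\alpha_k>0$). $C$ is the $J\times K$ matrix with $C_{jk}=1$ if $j=s(k)$, else $0$. **Discipline.** Classes at each station are strictly ranked; the server always works on the longest-waiting job of the highest-ranking non-empty class, preemptive-resume. $\mathcal L$ is the set of lowest-priority classes (one per station), $\mathcal H=\mathcal K\setminus\mathcal L$. **Markov process.** $X(t)=(Z(t),R_e(t),R_s(t))\in S=\mathbb Z_+^K\times\mathbb R_+^{\mathcal E}\times\mathbb R_+^K$ (right continuous): $Z_k(t)$ is the number of class $k$ jobs including one in service, $R_{e,k}(t)$ the remaining time until the next external class $k$ arrival, $R_{s,k}(t)$ the remaining service time of the class $k$ job in service (or the service time of the next class $k$ job if $Z_k(t)=0$). **Family and assumptions.** The $r$th network has parameters $\lambda^{(r)},m^{(r)}$ (hence $\alpha^{(r)}$), and the same sequences $T_{e,k}(\cdot),T_{s,k}(\cdot)$, $P$, $\mathcal E$ and priorities for all $r$. (A1) For some $\delta_0>0$, all $T_{e,k}$ ($k\in\mathcal E$) and $T_{s,k}$ ($k\in\mathcal K$) have finite $(2+\delta_0)$-th moments. (A2) There are $K$-vectors $\lambda\ge0,\lambda^*,m>0,m^*$ with $\lambda_k=\lambda_k^*=0$ for $k\notin\mathcal E$, $\lambda_k^{(r)}=\lambda_k-r\lambda_k^*>0$ ($k\in\mathcal E$), $m_k^{(r)}=m_k-rm_k^*>0$ ($k\in\mathcal K$), $C\,\mathrm{diag}(m)\alpha=e$ (all ones), $C[\mathrm{diag}(m^* )\alpha+\mathrm{diag}(m)\alpha^*]>0$,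 where $\alpha=(I-P^T)^{-1}\lambda$, $\alpha^*=(I-P^T)^{-1}\lambda^*$. (A3) For each $r\in(0,1]$, $X^{(r)}(\cdot)$ has a unique stationary distribution; $X^{(r)}=(Z^{(r)},R_e^{(r)},R_s^{(r)})$ has this distribution. (A4) For each $k\in\mathcal H$, $\{Z_k^{(r)}:r\in(0,1]\}$ is uniformly integrable. **Palm distributions (of the stationary $r$th network).** $N_{e,k}(t)$ and $N_{s,k}(t)$ count external class $k$ arrivals and class $k$ service completions in $(0,t]$. For Borel $B\subset S^2$, $$\mathbb P_{e,k}[B]=\tfrac1{\lambda_k^{(r)}}\mathbb E\Big[\int_{(0,1]}1((X^{(r)}(t-),X^{(r)}(t))\in B)dN_{e,k}(t)\Big],\quad \mathbb P_{s,k}[B]=\tfrac1{\alpha_k^{(r)}}\mathbb E\Big[\int_{(0,1]}1((X^{(r)}(t-),X^{(r)}(t))\in B)dN_{s,k}(t)\Big].$$ $(X^{(r)}_-,X^{(r)}_+)$ is the identity map on $S^2$, and $Z_-^{(r)}$ is the job-count component of the pre-jump state $X_-^{(r)}$. If several events occur simultaneously, they are ordered by a fixed tie-breaking rule and applied one after another, and $(X(t-),X(t))$ is replaced for each event by the intermediate states just before and after that event. *)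

(* Defs.v *)
From HB Require Import structures.
From mathcomp Require Import all_boot all_order all_algebra.
From mathcomp Require Import all_classical all_reals all_analysis.
Set Implicit Arguments.
Unset Strict Implicit.
Unset Printing Implicit Defensive.
Import Order.TTheory GRing.Theory Num.Theory.
Import numFieldNormedType.Exports.
Local Open Scope classical_set_scope.
Local Open Scope ring_scope.

(* [inl k]: external arrival to class k; [inr k]: class k service completion. *)
Definition event (K : nat) : finType := ('I_K + 'I_K)%type.

Record network (J K : nat) := Network {
  station : 'I_K -> 'I_J ;
  (* smaller rank = higher priority *)
  rank : 'I_K -> nat ;
  external : {set 'I_K} ;
  (* among the events still to be applied at an instant, the one applied next *)
  tie : {set event K} -> event K ;
  rank_strict : forall k l, station k = station l -> rank k = rank l -> k = l ;
  tie_in : forall A, A != finset.set0 -> tie A \in A }.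

Section topology.
Variables (J K : nat) (N : network J K).

Definition low_priority (k : 'I_K) : bool :=
  [forall l, (station N l == station N k) ==> (rank N l <= rank N k)%N].

Definition high_priority (k : 'I_K) : bool := ~~ low_priority k.

Definition constituency (R : realType) : 'M[R]_(J, K) :=
  \matrix_(j, k) (j == station N k)%:R.

End topology.

(* (Z, R_e, R_s).  R_e is indexed by all classes; its components outside the
   set of classes with external arrivals are 0 on [state_space] below. *)
Notation state R K := (K.-tuple nat * K.-tuple R * K.-tuple R)%type.

Section dynamics.
Variables (R : realType) (J K : nat) (N : network J K).
Implicit Types (x : state R K) (k : 'I_K) (e : event K).

Definition jobs x k : nat := tnth x.1.1 k.
Definition arrival_residual x k : R := tnth x.1.2 k.
Definition service_residual x k : R := tnth x.2 k.

Definition state_space : set (state R K) :=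
  [set x | forall k, [/\ 0 <= arrival_residual x k, 0 <= service_residual x k
                       & k \notin external N -> arrival_residual x k = 0]].

Definition in_service x k : bool :=
  (0 < jobs x k)%N &&
  [forall l, (station N l == station N k) && (rank N l < rank N k)%N
     ==> (jobs x l == 0%N)].

Definition clock x e : R :=
  match e with inl k => arrival_residual x k | inr k => service_residual x k end.

(* the events whose clock is running down *)
Definition running x : {set event K} :=
  [set e : event K | match e with
                     | inl k => k \in external N
                     | inr k => in_service x k
                     end]%SET.

Definition delay x : \bar R :=
  \big[mine/+oo%E]_(e in running x) (clock x e)%:E.

Definition next_events x : {set event K} :=
  [set e in running x | (clock x e)%:E == delay x]%SET.

Definition advance (h : R) x : state R K :=
  (x.1.1,
   [tuple arrival_residual x k - h *+ (inl k \in running x) | k < K],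
   [tuple service_residual x k - h *+ (inr k \in running x) | k < K]).

(* Realized interarrival times, service times and routing decisions; the n-th
   entry (n = 0, 1, ...) of [interarrival] or [service] for class k is the
   value to which the clock is reset at the (n+1)-st event of that kind.
   [None] means leaving the network. *)
Record inputs := Inputs {
  interarrival : 'I_K -> nat -> R ;
  service : 'I_K -> nat -> R ;
  routing : 'I_K -> nat -> option 'I_K }.

Variable u : inputs.

(* effect of the event e, the (n+1)-st of its kind *)
Definition apply_event e (n : nat) x : state R K :=
  match e with
  | inl k =>
      ([tuple (jobs x j + (j == k))%N | j < K],
       [tuple if j == k then interarrival u k n else arrival_residual x j
       | j < K],
       x.2)
  | inr k =>
      ([tuple (jobs x j - (j == k) + (routing u k n == Some j))%N | j < K],
       x.1.2,
       [tuple if j == k then service u k n else service_residual x j | j < K])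
  end.

(* The evolution is described event by event.  All events occurring
   simultaneously are collected in [pending] and applied one after another, in
   the order given by the tie-breaking rule; clocks run again once [pending] is
   empty (possibly for a duration 0). *)
Record configuration := Configuration {
  time : R ;
  pending : {set event K} ;
  occurred : event K -> nat ;
  current : state R K }.

Definition start x : configuration :=
  Configuration 0 finset.set0 (fun=> 0%N) x.

(* [pending (settle c)] is empty only if no event will ever occur after c; in
   that case [delay] is infinite and [fine] turns it into 0. *)
Definition settle (c : configuration) : configuration :=
  if pending c == finset.set0 then
    let h := fine (delay (current c)) in
    Configuration (time c + h) (next_events (current c)) (occurred c)
                  (advance h (current c))
  else c.

Definition fire (c : configuration) : configuration :=
  let c' := settle c in
  if pending c' == finset.set0 then c' else
  let e := tie N (pending c') in
  Configuration (time c') (pending c' :\ e)%SET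
                (fun f => (occurred c' f + (f == e))%N)
                (apply_event e (occurred c' e) (current c')).

Section path.
Variable x : state R K.

Definition conf (n : nat) : configuration := iter n fire (start x).

Definition event_time (n : nat) : \bar R :=
  if pending (settle (conf n)) == finset.set0 then +oo%E
  else (time (settle (conf n)))%:E.
Definition event_type (n : nat) : event K := tie N (pending (settle (conf n))).
Definition pre_state (n : nat) : state R K := current (settle (conf n)).
Definition post_state (n : nat) : state R K := current (conf n.+1).

(* X(t), right continuous, started in x.  The index is the number of events in
   [0, t]; it exists unless infinitely many events occur in [0, t]. *)
Definition process (t : R) : state R K :=
  let n := xget 0%N
    [set n | ((time (conf n))%:E <= t%:E)%E /\ (t%:E < event_time n)%E] in
  advance (t - time (conf n)) (current (conf n)).

End path.

End dynamics.

Section independence.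
Variables (d : measure_display) (Omega : measurableType d) (R : realType).
Variable P : probability Omega R.

Definition mutually_independent (I : eqType) (D : set I)
    (F : I -> set (set Omega)) : Prop :=
  forall s : seq I, uniq s -> (forall i, i \in s -> D i) ->
  forall A : I -> set Omega, (forall i, i \in s -> F i (A i)) ->
  P (\bigcap_(i in [set` s]) A i) = (\prod_(i <- s) P (A i))%E.

End independence.

Section model.
Variables (d : measure_display) (Omega : measurableType d) (R : realType).
Variable P : probability Omega R.
Variables (J K : nat) (N : network J K).

(* The i-th variable (i >= 1) of each sequence has index i - 1. *)
Record primitives := Primitives {
  Te : 'I_K -> nat -> {RV P >-> R} ;
  Ts : 'I_K -> nat -> {RV P >-> R} ;
  Phi : 'I_K -> nat -> Omega -> option 'I_K }.

Variable prim : primitives.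

Definition primitive_index : eqType :=
  ('I_K * nat + 'I_K * nat + 'I_K * nat)%type.

(* Te k is meaningful only for classes k with external arrivals. *)
Definition primitive_domain : set primitive_index :=
  [set i | if i is inl (inl (k, _)) then k \in external N else true].

Definition primitive_sigma (i : primitive_index) : set (set Omega) :=
  match i with
  | inl (inl (k, n)) => [set Te prim k n @^-1` B | B in measurable]
  | inl (inr (k, n)) => [set Ts prim k n @^-1` B | B in measurable]
  | inr (k, n) => [set Phi prim k n @^-1` B | B in setT]
  end.

Record primitives_assumption : Prop := {
  Phi_measurable : forall k n o, measurable (Phi prim k n @^-1` [set o]) ;
  prim_independent :
    mutually_independent P primitive_domain primitive_sigma ;
  Te_identical : forall k, k \in external N -> forall n (B : set R),
    measurable B -> P (Te prim k n @^-1` B) = P (Te prim k 0%N @^-1` B) ;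
  Ts_identical : forall k n (B : set R),
    measurable B -> P (Ts prim k n @^-1` B) = P (Ts prim k 0%N @^-1` B) ;
  Phi_identical : forall k n o,
    P (Phi prim k n @^-1` [set o]) = P (Phi prim k 0%N @^-1` [set o]) ;
  Te_ge0 : forall k, k \in external N -> forall n w, 0 <= Te prim k n w ;
  Ts_ge0 : forall k n w, 0 <= Ts prim k n w ;
  Te_mean : forall k, k \in external N -> ('E_P[Te prim k 0%N] = 1)%E ;
  Ts_mean : forall k, ('E_P[Ts prim k 0%N] = 1)%E }.

Definition routing_matrix : 'M[R]_K :=
  \matrix_(k, l) fine (P (Phi prim k 0%N @^-1` [set Some l])).

Definition total_rate (lambda : 'cV[R]_K) : 'cV[R]_K :=
  invmx (1%:M - routing_matrix^T) *m lambda.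

Section one_network.
Variables lambda m : 'cV[R]_K.

Definition realization (w : Omega) : inputs R K :=
  Inputs (fun k n => (lambda k 0)^-1 * Te prim k n w)
         (fun k n => m k 0 * Ts prim k n w)
         (fun k n => Phi prim k n w).

(* Under [pi \x P] the initial state has distribution pi and is independent of
   the primitives. *)
Definition X (t : R) (y : state R K * Omega) : state R K :=
  process N (realization y.2) y.1 t.

Definition stationary (pi : probability (state R K) R) : Prop :=
  pi (state_space N) = 1%E /\
  forall t, 0 <= t -> forall B, measurable B -> (pi \x P)%E (X t @^-1` B) = pi B.

Variable pi : probability (state R K) R.

(* E [ int_(0,1] 1((X(t-), X(t)) \in B) dN_e(t) ] *)
Definition expected_events (e : event K) (B : set (state R K * state R K)) :
    \bar R :=
  (\int[(pi \x P)%E]_y \sum_(0 <= n <oo)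
     (\1_[set y' : state R K * Omega |
           let u := realization y'.2 in
           [/\ (0 < event_time N u y'.1 n <= 1)%E,
               event_type N u y'.1 n = e &
               B (pre_state N u y'.1 n, post_state N u y'.1 n)]] y)%:E)%E.

Definition palm_e (k : 'I_K) (B : set (state R K * state R K)) : \bar R :=
  (((lambda k 0)^-1)%:E * expected_events (inl k) B)%E.

Definition palm_s (k : 'I_K) (B : set (state R K * state R K)) : \bar R :=
  (((total_rate lambda k 0)^-1)%:E * expected_events (inr k) B)%E.

End one_network.

Definition moment_assumption : Prop :=
  exists2 delta0 : R, 0 < delta0 &
    (forall k, k \in external N ->
       ('E_P[fun w => (Te prim k 0%N w `^ (2 + delta0))%R] < +oo)%E) /\
    (forall k, ('E_P[fun w => (Ts prim k 0%N w `^ (2 + delta0))%R] < +oo)%E).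

(* v^(r) = v - r v* *)
Definition at_param (v vs : 'cV[R]_K) (r : R) : 'cV[R]_K := v - r *: vs.

Record heavy_traffic (lambda lambdas m ms : 'cV[R]_K) : Prop := {
  lambda_ge0 : forall k, 0 <= lambda k 0 ;
  m_gt0 : forall k, 0 < m k 0 ;
  lambda_eq0 : forall k, k \notin external N ->
    lambda k 0 = 0 /\ lambdas k 0 = 0 ;
  lambdar_gt0 : forall r : R, 0 < r <= 1 -> forall k, k \in external N ->
    0 < at_param lambda lambdas r k 0 ;
  mr_gt0 : forall r : R, 0 < r <= 1 -> forall k, 0 < at_param m ms r k 0 ;
  critical_load :
    constituency N R *m diag_mx m^T *m total_rate lambda = const_mx 1 ;
  load_slope_gt0 : forall j,
    0 < (constituency N R *m
          (diag_mx ms^T *m total_rate lambda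
           + diag_mx m^T *m total_rate lambdas)) j 0 }.

Definition stability (lambda lambdas m ms : 'cV[R]_K)
    (pi : R -> probability (state R K) R) : Prop :=
  forall r : R, 0 < r <= 1 ->
    let st := stationary (at_param lambda lambdas r) (at_param m ms r) in
    st (pi r) /\
    forall pi', st pi' -> forall B, measurable B -> pi' B = pi r B.

Definition uniformly_integrable (pi : R -> probability (state R K) R)
    (f : state R K -> R) : Prop :=
  forall eps : R, 0 < eps -> exists c : R, forall r : R, 0 < r <= 1 ->
    (\int[pi r]_(x in [set x | (c < `|f x|)%R]) `|f x|%:E <= eps%:E)%E.

Definition state_space_collapse (pi : R -> probability (state R K) R) : Prop :=
  forall k, high_priority N k ->
    uniformly_integrable pi (fun x => (jobs x k)%:R).

End model.

Definition little_o_r (R : realType) (f : R -> \bar R) : Prop :=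
  (\forall r \near 0^'+, f r \is a fin_num) /\
  (fun r : R => fine (f r)) =o_ (0^'+) (fun r : R => r).

(* Main.v *)
Require Import Defs.
From HB Require Import structures.
From mathcomp Require Import all_boot all_order all_algebra.
From mathcomp Require Import all_classical all_reals all_analysis.
From mathcomp Require Import measurable_realfun ring lra zify.
Set Implicit Arguments.
Unset Strict Implicit.
Unset Printing Implicit Defensive.
Import Order.TTheory GRing.Theory Num.Theory.
Import numFieldNormedType.Exports.
Local Open Scope classical_set_scope.
Local Open Scope ring_scope.

(** The two Palm probabilities are, up to the factors [1 / lambda_k] and
    [1 / alpha_k], expected numbers of events of a given type e that occur in
    (0, 1] and find more than [1/r - 1] jobs of class l.  They are compared with
    the stationary tail [pi (Z_l > w)] for a level w of order [1/r]; that tail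
    is [o(r)] by uniform integrability and Markov's inequality ([ui_tail]).

    The comparison is a rate balance.  Let [R_e] be the clock of e, let a be
    the factor by which its primitives are scaled, and put
    [f(x) = ramp(Z_l) * clamp(R_e)], where ramp climbs from 0 at level c to 1 at
    level [c + w] in steps of [1/w], and [clamp(s) = min(s / a, 1)] for
    [s >= 0].  Along a path f changes in three ways.
    - While [R_e] runs down, f loses at most [1/a] per unit of time, and this
      only while [Z_l > c].
    - A class l service completion that is not of type e lowers f by at most
      [1/w], and this only if it finds [Z_l > c].  Other events do not lower f.
    - An event of type e happens when [R_e = 0], so f is 0 just before it; just
      after it f is at least 1/2 if it found [Z_l > c + w] and the new clock is
      at least [a/2].
    The state has law pi at time 0 and at time 1, so the expected gains are at
    most the expected losses ([potential_until], [balance]):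
    [1/2 * P(T_e >= 1/2) * E#(e-events with Z_l > c + w)
       <= 1/a * pi(Z_l > c) + 1/w * E#(class l completions with Z_l > c)].
    The probability factors out because the new clock is independent of the
    past ([fresh_input]), and it is positive because the primitives have mean
    one.

    If e is itself the completion of class l, the last term is absent, and
    [w = 1] bounds the expected number of class l completions that find
    [Z_l > c + 1] by the stationary tail.  Inserting this bound in the
    inequality for a general e gives [occurs_bound].  With c and w of order
    [1/r] its right-hand side stays below a constant times the stationary tail
    even after division by [lambda_k^(r)], which tends to 0 if the limiting rate [lambda_k] is 0: in
    the first term [1/a] is [lambda_k^(r)] itself, and in the second
    [w * lambda_k^(r)] is bounded away from 0.

    The expectations have to be justified.  Each configuration is a measurable
    function of the initial state and the primitives ([measurable_conf_iter]);
    infinitely many events before time 1 have probability zero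
    ([explosion_null]); the expected time spent with [Z_l > c] is computed by
    Tonelli's theorem ([crowded_graph_measure]). *)

(** * Single steps of the dynamics *)

Section dynamics_lemmas.
Variables (R : realType) (J K : nat) (N : network J K).
Implicit Types (x : state R K) (c : configuration R K) (u : inputs R K).
Implicit Types (e f : event K).

Definition possible : {set event K} :=
  [set f : event K | if f is inl k then k \in external N else true]%SET.

Definition input u f n : R :=
  match f with inl k => interarrival u k n | inr k => service u k n end.

Lemma running_possible x f : f \in running N x -> f \in possible.
Proof. by rewrite !inE; case: f. Qed.

Lemma clock_advance h x f :
  clock (advance N h x) f = clock x f - h *+ (f \in running N x).
Proof.
by case: f => k /=; rewrite /arrival_residual /service_residual/= tnth_mktuple.
Qed.

Lemma clock_apply_event u e n x f :
  clock (apply_event u e n x) f = if f == e then input u e n else clock x f.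
Proof.
case: e => k; case: f => j //=;
  rewrite /arrival_residual /service_residual/= ?tnth_mktuple//.
Qed.

Lemma jobs_apply_event_ge u e n x l :
  (jobs x l <= jobs (apply_event u e n x) l + (e == inr l))%N.
Proof.
case: e => k; rewrite /jobs/= tnth_mktuple -/(jobs x l) ?leq_addr//.
  by rewrite -addnA leq_addr.
have -> : ((inr k : event K) == inr l) = (l == k) by rewrite eq_sym.
by lia.
Qed.

Lemma delayP x : running N x != finset.set0 ->
  exists2 e, e \in running N x & delay N x = (clock x e)%:E /\
    forall f, f \in running N x -> clock x e <= clock x f.
Proof.
case/set0Pn => e0 e0r.
case: (arg_minP (clock x) e0r) => e er emin; exists e => //; split; last first.
  by move=> f fr; exact: emin.
apply/eqP; rewrite eq_le; apply/andP; split.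
  by rewrite /delay; apply: bigmin_le_cond.
by apply/bigmin_geP; split => [|f fr]; rewrite ?leey// lee_fin emin.
Qed.

Definition coherent c := (forall f, f \in possible -> 0 <= clock (current c) f) /\
  (forall f, f \in pending c -> f \in possible /\ clock (current c) f = 0).

(** * The potential *)

Definition ramp (c0 w z : nat) : R := (minn (z - c0) w)%:R / w%:R.
(** The truncation at 1 keeps the potential bounded, the one at 0 makes it
    nonnegative also at illegal states. *)
Definition clamp (a s : R) : R := Num.max 0 (Num.min (s / a) 1).
Definition potential (e : event K) l (c0 w : nat) (a : R) (x : state R K) : R :=
  ramp c0 w (jobs x l) * clamp a (clock x e).

Lemma ramp_bound (c0 w z : nat) : (0 < w)%N -> 0 <= ramp c0 w z <= (c0 < z)%N%:R.
Proof.
move=> w0; rewrite /ramp divr_ge0//= ler_pdivrMr ?ltr0n// -natrM ler_nat.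
by case: ltnP; lia.
Qed.

Lemma ramp_homo (c0 w z z' : nat) : (0 < w)%N -> (z <= z')%N ->
  ramp c0 w z <= ramp c0 w z'.
Proof. by move=> w0 zz'; rewrite ler_pM2r ?invr_gt0 ?ltr0n// ler_nat; lia. Qed.

Lemma ramp_step (c0 w z z' : nat) : (0 < w)%N -> (z <= z'.+1)%N ->
  ramp c0 w z <= ramp c0 w z' + (c0 < z)%N%:R / w%:R.
Proof.
move=> w0 zz'; rewrite -mulrDl ler_pM2r ?invr_gt0 ?ltr0n// -natrD ler_nat.
by case: ltnP; lia.
Qed.

Lemma ramp_top (c0 w z : nat) : (0 < w)%N -> (c0 + w <= z)%N -> ramp c0 w z = 1.
Proof.
move=> w0 zw; rewrite /ramp (_ : minn _ _ = w) ?divff ?pnatr_eq0 -?lt0n//; lia.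
Qed.

Lemma clamp_bound a s : 0 <= clamp a s <= 1.
Proof. by rewrite /clamp le_max lexx/= ge_max ler01/= ge_min lexx orbT. Qed.

Lemma clamp_ge a theta s : 0 < a -> theta <= 1 -> theta * a <= s -> theta <= clamp a s.
Proof.
move=> a0 th1; rewrite -ler_pdivlMr// => sa.
by rewrite /clamp le_max le_min sa th1 orbT.
Qed.

Lemma clamp0 a s : 0 < a -> s <= 0 -> clamp a s = 0.
Proof.
move=> a0 s0; apply/max_idPl; rewrite ge_min; apply/orP; left.
by rewrite ler_pdivrMr// mul0r.
Qed.

Lemma clamp_lip a s s' h : 0 < a -> 0 <= h -> s - h <= s' ->
  clamp a s <= clamp a s' + h / a.
Proof.
move=> a0 h0 ss'; have ha : 0 <= h / a by rewrite divr_ge0// ltW.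
have : s / a <= s' / a + h / a by rewrite -mulrDl ler_pM2r ?invr_gt0//; lra.
rewrite /clamp /Num.max /Num.min; do ![case: ifPn => //]; rewrite -?leNgt; lra.
Qed.

Lemma potential_bound e l (c0 w : nat) a x : (0 < w)%N ->
  0 <= potential e l c0 w a x <= 1.
Proof.
move=> w0; have /andP[r0 r1] := ramp_bound c0 (jobs x l) w0.
have /andP[k0 k1] := clamp_bound a (clock x e).
rewrite mulr_ge0//= mulr_ile1//; apply: le_trans r1 _.
by rewrite lern1; case: ltnP.
Qed.

Lemma potential_flow e l (c0 w : nat) a x x' h : (0 < w)%N -> 0 < a -> 0 <= h ->
    jobs x' l = jobs x l -> clock x e - h <= clock x' e ->
  potential e l c0 w a x
    <= potential e l c0 w a x' + (c0 < jobs x l)%N%:R * h / a.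
Proof.
move=> w0 a0 h0 jE xx'; rewrite /potential jE.
have /andP[r0 r1] := ramp_bound c0 (jobs x l) w0.
have := clamp_lip a0 h0 xx'; have : 0 <= h / a by rewrite divr_ge0// ltW.
set A := clamp a _; set B := clamp a _; set H := h / a; rewrite -mulrA -/H.
move: r0 r1; set r := ramp _ _ _; set b := _%:R; nra.
Qed.

(** * Paths

    With external arrivals some clock always runs, so the dynamics never
    stops. *)

Section nonstuck.
Hypothesis external_neq0 : external N != finset.set0.

Lemma running_neq0 x : running N x != finset.set0.
Proof.
by case/set0Pn: external_neq0 => k kE; apply/set0Pn; exists (inl k); rewrite inE.
Qed.

Lemma settleP c : coherent c -> let c' := settle N c in
  [/\ coherent c', pending c' != finset.set0, time c <= time c',
      occurred c' = occurred c &
      (forall l, jobs (current c') l = jobs (current c) l) /\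
      (forall f, clock (current c) f - (time c' - time c)
                   <= clock (current c') f <= clock (current c) f)].
Proof.
move=> [c0 cp]; rewrite /settle; case: ifPn => [p0|p0] /=; last first.
  by split => //; split => // f; rewrite subrr subr0 lexx.
have [e er [dE emin]] := delayP (running_neq0 (current c)).
have e0 := c0 _ (running_possible er).
rewrite /next_events dE /= addrAC subrr add0r.
split => //; last 1 first.
- split => // f; rewrite clock_advance.
  by case: (f \in running _ _); rewrite ?mulr1n ?mulr0n ?lexx ?subr0 /=; lra.
- split => [f /c0 f0|f] /=; rewrite clock_advance.
    have := emin f.
    by case: (f \in running _ _) => [/(_ isT)|_]; rewrite ?mulr1n ?mulr0n; lra.
  rewrite inE => /andP[fr /eqP[->]]; rewrite fr mulr1n subrr; split => //.
  exact: running_possible fr.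
- by apply/set0Pn; exists e; rewrite inE er/=.
- by rewrite lerDl.
Qed.

Section path.
Variables (u : inputs R K) (x : state R K).
Hypothesis input_ge0 : forall f n, f \in possible -> 0 <= input u f n.
Hypothesis x_state : state_space N x.

Local Notation conf := (conf N u x).
Local Notation fired := (event_type N u x).
Local Notation t n := (time (conf n)).

Lemma fireE c : pending (settle N c) != finset.set0 -> let c' := settle N c in
  let e := tie N (pending c') in
  fire N u c = Configuration (time c') (pending c' :\ e)%SET
    (fun f => (occurred c' f + (f == e))%N)
    (apply_event u e (occurred c' e) (current c')).
Proof. by rewrite /fire => /negbTE ->. Qed.

Lemma coherent_conf n : coherent (conf n).
Proof.
elim: n => [|n IH] /=.
  split => [f _|f] /=; last by rewrite inE.
  by case: f => k; have [] := x_state k.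
have [[c0 cp] p0 _ _ _] := settleP IH.
rewrite fireE//; split => f /=; rewrite clock_apply_event.
  by move=> fp; case: eqVneq => [<-|_]; [exact: input_ge0|exact: c0].
by rewrite in_setD1 => /andP[/negbTE -> /cp].
Qed.

(** All that is used about a step later on.  The clock of the event that fires
    runs out during the step, so it was at most the time elapsed; no other
    clock runs faster than time. *)
Lemma conf_stepP n :
  [/\ t n <= t n.+1, event_time N u x n = (t n.+1)%:E,
      forall f, occurred (conf n.+1) f = (occurred (conf n) f + (f == fired n))%N,
      fired n \in possible &
      [/\ clock (current (conf n)) (fired n) <= t n.+1 - t n,
        forall f, f != fired n ->
          clock (current (conf n)) f - (t n.+1 - t n)
            <= clock (current (conf n.+1)) f <= clock (current (conf n)) f,
        clock (current (conf n.+1)) (fired n)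
          = input u (fired n) (occurred (conf n) (fired n)) &
        forall l, (jobs (current (conf n)) l <=
          jobs (current (conf n.+1)) l + (fired n == inr l))%N]].
Proof.
have [[c0 cp] p0 tle oE [jE cE]] := settleP (coherent_conf n).
rewrite /= fireE//= /event_time (negbTE p0) -/(fired n) oE.
have [fp f0] := cp _ (tie_in N p0).
split => //; split => //.
- by have /andP[] := cE (fired n); rewrite f0; lra.
- by move=> f ff; rewrite clock_apply_event (negbTE ff).
- by rewrite clock_apply_event eqxx.
- by move=> l; rewrite -jE jobs_apply_event_ge.
Qed.

Lemma time_ndecr n n' : (n <= n')%N -> t n <= t n'.
Proof.
apply: (@homo_leq _ (fun n => t n) (fun a b => a <= b)) => //.
  by move=> a b c; exact: le_trans.
by move=> i; have [] := conf_stepP i.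
Qed.

(** Between two events of type f a whole input is consumed.  The input that
    the clock of f currently holds is not used up yet, hence the predecessor. *)
Lemma time_sum_input f n : f \in possible ->
  \sum_(0 <= i < (occurred (conf n) f).-1) input u f i <= t n.
Proof.
move=> fp; suff [] : 0 <= t n /\
  (\sum_(0 <= i < (occurred (conf n) f).-1) input u f i <= t n) /\
  (\sum_(0 <= i < occurred (conf n) f) input u f i
    <= t n + clock (current (conf n)) f) by move=> _ [].
elim: n => [|n [t0 [IH1 IH2]]].
  rewrite /= !big_geq//; split => //; split => //; rewrite add0r.
  by have [/(_ f fp)] := coherent_conf 0.
have [tn _ oE _ [cf cn ci _]] := conf_stepP n.
split; first exact: le_trans tn.
have [ff|ff] := eqVneq f (fired n).
  move: cf ci; rewrite oE -ff eqxx addn1 /= => cf ->.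
  by rewrite big_nat_recr//=; split; lra.
rewrite oE (negbTE ff) addn0; split; first exact: le_trans tn.
by have /andP[] := cn _ ff; lra.
Qed.

Section potential_path.
Variables (e : event K) (l : 'I_K) (c0 w : nat) (a theta : R).
Hypotheses (w0 : (0 < w)%N) (a0 : 0 < a) (theta1 : 0 <= theta <= 1).

Local Notation pot := (potential e l c0 w a).

(** One step of the balance: gain on the left, losses on the right. *)
Lemma potential_step n :
  theta * [&& fired n == e, c0 + w < jobs (current (conf n)) l
            & (theta * a <= input u e (occurred (conf n) e))%R]%N%:R
    + pot (current (conf n))
  <= pot (current (conf n.+1))
     + (c0 < jobs (current (conf n)) l)%N%:R * (t n.+1 - t n) / a
     + ((e != inr l) && (fired n == inr l)
         && (c0 < jobs (current (conf n)) l))%N%:R / w%:R.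
Proof.
have [tn _ _ _ [cf cn ci jn]] := conf_stepP n.
move: cf cn ci (jn l); set x1 := current _; set x2 := current _.
move=> cf cn ci jl.
have h0 : 0 <= t n.+1 - t n by lra.
have /andP[p0 _] := potential_bound e l c0 a x2 w0.
have H0 b : 0 <= (b : bool)%:R / w%:R :> R by rewrite divr_ge0.
have [fe|fe] := eqVneq (fired n) e.
  (* The clock of e has run down, so the flow has consumed all the potential. *)
  have P1 : pot x1 <= (c0 < jobs x1 l)%N%:R * (t n.+1 - t n) / a.
    rewrite /potential; have /andP[r0 r1] := ramp_bound c0 (jobs x1 l) w0.
    have cl : clamp a (clock x1 e) <= (t n.+1 - t n) / a.
      rewrite -[leRHS]add0r -[X in X + _](@clamp0 a 0)//; apply: clamp_lip => //.
      by move: cf; rewrite fe; lra.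
    have /andP[k0 _] := clamp_bound a (clock x1 e).
    by rewrite -mulrA ler_pM.
  suff P2 : theta * [&& true, c0 + w < jobs x1 l
      & (theta * a <= input u e (occurred (conf n) e))%R]%N%:R <= pot x2.
    by have := H0 ((e != inr l) && (fired n == inr l) && (c0 < jobs x1 l)%N); lra.
  rewrite andTb; case: (ltnP _ (jobs x1 l)) => [zl|_]; last by rewrite mulr0.
  case: (leP (theta * a)) => [th|_]; last by rewrite mulr0.
  rewrite mulr1 /potential ramp_top//; last by move: jl zl; clear; lia.
  rewrite mul1r; apply: clamp_ge => //; first by case/andP: theta1.
  by rewrite -fe ci fe.
rewrite mulr0 add0r; have e_f : e != fired n by rewrite eq_sym.
have jump : ramp c0 w (jobs x1 l) <= ramp c0 w (jobs x2 l) +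
    ((e != inr l) && (fired n == inr l) && (c0 < jobs x1 l))%N%:R / w%:R.
  have [fl|fl] := eqVneq (fired n) (inr l).
    rewrite -fl e_f /=; apply: ramp_step => //; move: jl; rewrite fl eqxx; clear; lia.
  rewrite andbF mul0r addr0; apply: ramp_homo => //; move: jl; rewrite (negbTE fl); clear; lia.
have /andP[k0 k1] := clamp_bound a (clock x2 e).
have /andP[ka kb] := clamp_bound a (clock x1 e).
have /andP[r0 r1] := ramp_bound c0 (jobs x1 l) w0.
have L : clamp a (clock x1 e) <= clamp a (clock x2 e) + (t n.+1 - t n) / a.
  by apply: clamp_lip => //; have /andP[] := cn _ e_f.
have := H0 ((e != inr l) && (fired n == inr l) && (c0 < jobs x1 l)%N).
have : 0 <= (t n.+1 - t n) / a by rewrite mulr_ge0 ?invr_ge0// ltW.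
move: r0 r1 k0 k1 L jump; rewrite /potential -mulrA.
set A := ramp c0 w (jobs x1 l); set B := ramp c0 w (jobs x2 l).
set C := clamp a (clock x1 e); set D := clamp a (clock x2 e).
set H := (_ - _) / a; set E := _ / w%:R; set b := _%:R.
move=> A0 Ab D0 D1 CD AB H00 E0.
have : A * C <= A * D + b * H.
  apply: (@le_trans _ _ (A * (D + H))); first exact: ler_wpM2l.
  by rewrite mulrDr lerD2l ler_wpM2r.
have : A * D <= B * D + E.
  apply: (@le_trans _ _ ((B + E) * D)); first exact: ler_wpM2r.
  by rewrite mulrDl lerD2l ler_piMr.
lra.
Qed.

Lemma potential_path n :
  theta * \sum_(i < n) [&& fired i == e, c0 + w < jobs (current (conf i)) l
            & (theta * a <= input u e (occurred (conf i) e))%R]%N%:R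
    + pot x
  <= pot (current (conf n))
     + (\sum_(i < n) (c0 < jobs (current (conf i)) l)%N%:R * (t i.+1 - t i)) / a
     + (\sum_(i < n) ((e != inr l) && (fired i == inr l)
         && (c0 < jobs (current (conf i)) l))%N%:R) / w%:R.
Proof.
elim: n => [|n IH]; first by rewrite !big_ord0 mulr0 !mul0r add0r !addr0.
rewrite !big_ord_recr/= mulrDr !mulrDl.
have := potential_step n; move: IH => /=; lra.
Qed.

End potential_path.

Lemma sum_occurred n : (\sum_f occurred (conf n) f)%N = n.
Proof.
elim: n => [|n IH]; first by rewrite big1.
have [_ _ oE _ _] := conf_stepP n.
under eq_bigr do rewrite oE.
by rewrite big_split/= IH (bigD1 (fired n))//= eqxx big1 ?addn1// => f /negbTE ->.
Qed.

Lemma occurred_impossible n f : f \notin possible -> occurred (conf n) f = 0%N.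
Proof.
move=> fp; elim: n => [//|n IH]; have [_ _ -> pos _] := conf_stepP n.
by rewrite IH; case: eqVneq => // fE; rewrite fE pos in fp.
Qed.

(** There are finitely many types, so one of them occurs infinitely often, and
    [time_sum_input] bounds all partial sums of its inputs. *)
Lemma explosion : (forall n, t n <= 1) ->
  exists2 f, f \in possible & forall m, \sum_(0 <= i < m) input u f i <= 1.
Proof.
move=> t1; apply: contrapT => noexp.
have big f : exists m, f \in possible -> 1 < \sum_(0 <= i < m) input u f i.
  apply: contrapT => /forallNP nm; apply: noexp; exists f; last first.
    by move=> m; rewrite leNgt; apply/negP => ?; exact: (nm m).
  by apply: contrapT => fp; exact: (nm 0%N).
have [M MP] := choice big.
have occM n f : (occurred (conf n) f <= M f)%N.
  have [fp|/occurred_impossible -> //] := boolP (f \in possible).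
  rewrite leqNgt; apply/negP => Mocc.
  have := le_trans (time_sum_input n fp) (t1 n); rewrite leNgt => /negP; apply.
  apply: lt_le_trans (MP f fp) _.
  rewrite (@big_cat_nat _ _ _ (M f) 0%N (occurred (conf n) f).-1)//=; last by lia.
  by rewrite lerDl sumr_ge0// => i _; exact: input_ge0.
have := sum_occurred (\sum_f M f).+1.
have : (\sum_f occurred (conf (\sum_f M f).+1) f <= \sum_f M f)%N.
  by apply: leq_sum => f _; exact: occM.
lia.
Qed.

Lemma time_inj n n' s : t n <= s < t n.+1 -> t n' <= s < t n'.+1 -> n = n'.
Proof.
move=> /andP[n1 n2] /andP[n1' n2']; case: (ltngtP n n') => //.
  by move=> /time_ndecr h; exfalso; lra.
by move=> /time_ndecr h; exfalso; lra.
Qed.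

Lemma process_in n s : t n <= s < t n.+1 ->
  process N u x s = advance N (s - t n) (current (conf n)).
Proof.
move=> ns; rewrite /process; set A := [set _ | _].
suff -> : xget 0%N A = n by [].
apply: xget_unique => [|n' [+ +]].
  by have [_ evE _ _ _] := conf_stepP n; rewrite /A/= evE !lee_fin !lte_fin; case/andP: ns.
have [_ -> _ _ _] := conf_stepP n'; rewrite lee_fin lte_fin => ? ?.
by apply/esym/(time_inj ns); apply/andP.
Qed.

Lemma process_out s : (forall n, ~~ (t n <= s < t n.+1)) ->
  process N u x s = advance N s x.
Proof.
move=> ns; rewrite /process; set A := [set _ | _].
suff -> : xget 0%N A = 0%N by rewrite /= subr0.
apply: xgetPN => n [+ +]; have [_ -> _ _ _] := conf_stepP n.
by rewrite lee_fin lte_fin => ? ?; move/negP: (ns n); apply; apply/andP.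
Qed.

(** [potential_path] continued from the last event before s to s itself. *)
Lemma potential_until e (l : 'I_K) (c0 w : nat) (a theta : R) n s :
    (0 < w)%N -> 0 < a -> 0 <= theta <= 1 -> t n <= s < t n.+1 ->
  theta * \sum_(i < n) [&& fired i == e, c0 + w < jobs (current (conf i)) l
            & (theta * a <= input u e (occurred (conf i) e))%R]%N%:R
    + potential e l c0 w a x
  <= potential e l c0 w a (process N u x s)
     + (\sum_(i < n.+1) (c0 < jobs (current (conf i)) l)%N%:R
          * (Num.min (t i.+1) s - Num.min (t i) s)) / a
     + (\sum_(i < n) ((e != inr l) && (fired i == inr l)
         && (c0 < jobs (current (conf i)) l))%N%:R) / w%:R.
Proof.
move=> w0 a0 th ns; rewrite (process_in ns); have /andP[tn sn] := ns.
apply: le_trans (@potential_path e l c0 w a theta w0 a0 th n) _.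
rewrite lerD2r big_ord_recr/= (min_r (ltW sn)) (min_l tn).
have -> : \sum_(i < n) (c0 < jobs (current (conf i)) l)%N%:R
      * (Num.min (t i.+1) s - Num.min (t i) s)
    = \sum_(i < n) (c0 < jobs (current (conf i)) l)%N%:R * (t i.+1 - t i).
  by apply: eq_bigr => i _; rewrite !min_l// (le_trans _ tn)// time_ndecr// ltnW.
rewrite mulrDl addrA (addrAC (potential _ _ _ _ _ _)) lerD2r.
have h0 : 0 <= s - t n by lra.
apply: (@potential_flow e l c0 w a _ _ _ w0 a0 h0); first by [].
rewrite clock_advance; case: (e \in _); rewrite ?mulr1n ?mulr0n; lra.
Qed.

End path.
End nonstuck.
End dynamics_lemmas.

(** * Measurability by countable covers *)

Lemma measurable_fun_cover d (T : measurableType d) d' (T' : measurableType d')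
    (C : countType) (A : C -> set T) (g : T -> T') :
  (forall c, measurable (A c)) -> (forall y, exists c, A c y) ->
  (forall c, exists2 gc, measurable_fun setT gc & forall y, A c y -> g y = gc y) ->
  measurable_fun setT g.
Proof.
move=> mA cov pg _ B mB; rewrite setTI.
have /choice[gc gcP] c : exists gc : T -> T',
    measurable_fun setT gc /\ forall y, A c y -> g y = gc y.
  by have [h] := pg c; exists h.
have -> : g @^-1` B = \bigcup_c (A c `&` gc c @^-1` B).
  apply/seteqP; split => [y By|y [c _ [Ay]]] /=; last by rewrite -(gcP c).2.
  by have [c Ay] := cov y; exists c => //; split => //; rewrite /= -(gcP c).2.
apply: countable_bigcupT_measurable => // c; apply: measurableI => //.
by rewrite -[X in measurable X]setTI; exact: (gcP c).1.
Qed.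

Section pieces.
Context d (T : measurableType d) (C : countType) (D : T -> C).
Hypothesis mD : forall c, measurable [set y | D y = c].

Lemma measurable_pieces (Q : T -> Prop) :
  (forall c, exists2 A : set T, measurable A & forall y, D y = c -> (Q y <-> A y)) ->
  measurable [set y | Q y].
Proof.
move=> mQ; have /choice[A AP] c : exists A : set T,
    measurable A /\ forall y, D y = c -> (Q y <-> A y).
  by have [A] := mQ c; exists A.
have -> : [set y | Q y] = \bigcup_c ([set y | D y = c] `&` A c).
  apply/seteqP; split => [y Qy|y [c _ [/= Dy Ay]]]; last exact/((AP c).2 _ Dy).
  by exists (D y) => //; split => //; exact/((AP (D y)).2 _ erefl).
by apply: countable_bigcupT_measurable => // c; apply: measurableI => //; exact: (AP c).1.
Qed.

Lemma measurable_discrete (Q : C -> Prop) : measurable [set y | Q (D y)].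
Proof.
apply: measurable_pieces => c.
exists [set y | Q c] => [|y -> //].
have [Qc|Qc] := pselect (Q c).
  by rewrite (_ : [set _ | _] = setT)//; apply/seteqP; split.
by rewrite (_ : [set _ | _] = set0)//; apply/seteqP; split.
Qed.

Lemma measurable_fun_pieces d' (T' : measurableType d') (g : T -> T') :
  (forall c, exists2 gc, measurable_fun setT gc & forall y, D y = c -> g y = gc y) ->
  measurable_fun setT g.
Proof. by apply: (measurable_fun_cover mD) => y; exists (D y). Qed.

End pieces.

(** * Measurability of the configurations

    The discrete part of a configuration takes countably many values and
    determines which clocks run and which event fires next; once it is fixed,
    the real coordinates evolve by sums and minima. *)

Section measurable_conf.
Variables (R : realType) (J K : nat) (N : network J K).
Context d (T : measurableType d).
Implicit Types (c : T -> configuration R K).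

Definition discrete (q : configuration R K) :
    ({set event K} * {ffun event K -> nat} * K.-tuple nat)%type :=
  (pending q, [ffun f => occurred q f], (current q).1.1).

(** Measurability of a map into configurations, for the sigma-algebra generated
    by the discrete part, the time and the clocks.  The source T varies: it is
    the product of state space and sample space, and also the sample space with
    the sigma-algebra of all primitives but one. *)
Definition measurable_conf c : Prop :=
  [/\ forall q, measurable [set y | discrete (c y) = q],
      measurable_fun setT (fun y => time (c y)) &
      forall f, measurable_fun setT (fun y => clock (current (c y)) f)].

Lemma in_service_jobs (x x' : state R K) k : x.1.1 = x'.1.1 ->
  in_service N x k = in_service N x' k.
Proof. by rewrite /in_service /jobs => ->. Qed.

Lemma running_jobs (x x' : state R K) : x.1.1 = x'.1.1 -> running N x = running N x'.
Proof.
move=> xx'; apply/setP => -[k|k]; rewrite !inE//.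
exact: in_service_jobs.
Qed.

Lemma measurable_eqb (a b : T -> bool) :
  measurable_fun setT a -> measurable_fun setT b -> measurable [set y | a y = b y].
Proof.
move=> ma mb.
have -> : [set y | a y = b y] =
    (a @^-1` [set true] `&` b @^-1` [set true]) `|`
    (a @^-1` [set false] `&` b @^-1` [set false]).
  apply/seteqP; split => y /=; first by case: (a y) (b y) => -[] // _; [left|right].
  by move=> [] [-> ->].
by apply: measurableU; apply: measurableI; rewrite -[X in measurable X]setTI;
  [exact: ma|exact: mb|exact: ma|exact: mb].
Qed.

(** [delay] with the set of running clocks kept fixed. *)
Definition delay_on (A : {set event K}) (x : state R K) : \bar R :=
  \big[mine/+oo%E]_(e in A) (clock x e)%:E.

Lemma measurable_delay_on c (A : {set event K}) : measurable_conf c ->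
  measurable_fun setT (fun y => delay_on A (current (c y))).
Proof.
move=> [_ _ mc]; rewrite /delay_on; under eq_fun do rewrite -big_enum.
elim: (enum A) => [|e s IH].
  by under eq_fun do rewrite big_nil; exact: measurable_cst.
under eq_fun do rewrite big_cons; apply: measurable_mine => //.
by apply/measurable_EFinP; exact: mc.
Qed.

(** A representative state for functions of the job counts. *)
Definition at_jobs (z : K.-tuple nat) : state R K :=
  (z, [tuple (0 : R) | _ < K], [tuple (0 : R) | _ < K]).

Lemma measurable_settle c : measurable_conf c ->
  measurable_conf (fun y => settle N (c y)).
Proof.
move=> mc; have [mD mt mk] := mc.
pose run (z : K.-tuple nat) := running N (at_jobs z).
have runE q y : discrete (c y) = q -> running N (current (c y)) = run q.2.
  by move=> <-; exact: running_jobs.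
pose dly z y := delay_on (run z) (current (c y)).
have mdly z : measurable_fun setT (dly z) by exact: measurable_delay_on.
have dlyE q y : discrete (c y) = q -> delay N (current (c y)) = dly q.2 y.
  by move=> /runE qE; rewrite /delay qE.
have mfdly z : measurable_fun setT (fun y => fine (dly z y)).
  exact: measurableT_comp.
have settle0 q y : discrete (c y) = q -> q.1.1 != finset.set0 ->
    settle N (c y) = c y.
  by move=> <- /= /negbTE q0; rewrite /settle q0.
have settle1 q y : discrete (c y) = q -> q.1.1 == finset.set0 ->
    settle N (c y) = Configuration (time (c y) + fine (dly q.2 y))
      [set e in run q.2 | (clock (current (c y)) e)%:E == dly q.2 y]%SET
      (occurred (c y)) (advance N (fine (dly q.2 y)) (current (c y))).
  by move=> qE; rewrite -(dlyE _ _ qE) -(runE _ _ qE) -qE /settle /= => ->.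
split => [p'| |f].
- apply: (measurable_pieces mD) => q.
  have [p0|p0] := boolP (q.1.1 == finset.set0); last first.
    by exists [set y | discrete (c y) = p'] => // y qE; rewrite (settle0 _ _ qE p0).
  exists ([set y | (q.1.2, q.2) = (p'.1.2, p'.2)] `&`
     \bigcap_(f in [set: event K])
     [set y | ((f \in run q.2) && ((clock (current (c y)) f)%:E == dly q.2 y))
       = (f \in p'.1.1)]).
    apply: measurableI.
      exact: (@measurable_discrete _ _ _ _ mD (fun _ => (q.1.2, q.2) = (p'.1.2, p'.2))).
    apply: fin_bigcap_measurable => // f _; apply: measurable_eqb => //.
    apply: measurable_and => //.
    apply: (@measurable_fun_bool _ _ _ _ true).
    rewrite (_ : _ @^-1` _ = [set y | (clock (current (c y)) f)%:E = dly q.2 y]).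
      by apply: measurable_eqe => //; exact/measurable_EFinP.
    by apply/seteqP; split => y /= /eqP.
  move=> y qE; rewrite (settle1 _ _ qE p0) /discrete/=.
  case: q qE {p0} => -[q1 q2] q3 /= [qE1 qE2 qE3].
  case: p' => -[p1 p2] p3 /=; rewrite qE2 qE3; split.
    move=> [<- -> ->]; split => // f _ /=.
    by rewrite [RHS]finset.in_set.
  move=> [[-> ->] h]; congr (_, _, _); apply/setP => f.
  by rewrite [LHS]finset.in_set; exact: h.
- apply: (measurable_fun_pieces mD) => q.
  have [p0|p0] := boolP (q.1.1 == finset.set0); last first.
    by exists (fun y => time (c y)) => // y qE; rewrite (settle0 _ _ qE p0).
  exists (fun y => time (c y) + fine (dly q.2 y)).
    by apply: measurable_funD.
  by move=> y qE; rewrite (settle1 _ _ qE p0).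
- apply: (measurable_fun_pieces mD) => q.
  have [p0|p0] := boolP (q.1.1 == finset.set0); last first.
    by exists (fun y => clock (current (c y)) f) => // y qE; rewrite (settle0 _ _ qE p0).
  exists (fun y => clock (current (c y)) f - fine (dly q.2 y) * (f \in run q.2)%:R).
    by apply: measurable_funB => //; apply: measurable_funM.
  move=> y qE; rewrite (settle1 _ _ qE p0)/= clock_advance (runE _ _ qE).
  by rewrite mulr_natr.
Qed.

Variable U : T -> inputs R K.
Hypothesis mU : forall f n, measurable_fun setT (fun y => input (U y) f n).
Hypothesis mrouting : forall k n o, measurable [set y | routing (U y) k n = o].

Lemma measurable_fire c : measurable_conf c ->
  measurable_conf (fun y => fire N (U y) (c y)).
Proof.
move=> /measurable_settle; set c' := fun y => settle N (c y) => mc.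
have [mD mt mk] := mc.
have fire0 q y : discrete (c' y) = q -> q.1.1 == finset.set0 ->
    fire N (U y) (c y) = c' y.
  by move=> <- /= q0; rewrite /fire q0.
have fire1 q y : discrete (c' y) = q -> q.1.1 != finset.set0 ->
    fire N (U y) (c y) = Configuration (time (c' y)) (q.1.1 :\ tie N q.1.1)%SET
      (fun f => (q.1.2 f + (f == tie N q.1.1))%N)
      (apply_event (U y) (tie N q.1.1) (q.1.2 (tie N q.1.1)) (current (c' y))).
  move=> <- /= /negbTE q0; rewrite /fire q0 ffunE; congr Configuration.
  by apply/funext => f; rewrite ffunE.
split => [p'| |f].
- apply: (measurable_pieces mD) => q.
  have [p0|p0] := boolP (q.1.1 == finset.set0).
    by exists [set y | discrete (c' y) = p'] => // y qE; rewrite (fire0 _ _ qE p0).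
  set e := tie N q.1.1.
  pose after (o : option 'I_K) := ((q.1.1 :\ e)%SET,
    [ffun f => (q.1.2 f + (f == e))%N],
    (apply_event (Inputs (fun _ _ => 0) (fun _ _ => 0) (fun _ _ => o) : inputs R K)
      e 0 (at_jobs q.2)).1.1).
  pose rt y := if e is inr k then routing (U y) k (q.1.2 e) else None.
  have mrt o : measurable [set y | rt y = o].
    rewrite /rt; case: e {after rt} => k; last exact: mrouting.
    exact: (@measurable_discrete _ _ _ _ mD (fun _ => None = o)).
  exists [set y | after (rt y) = p'].
    exact: (measurable_discrete mrt (fun o => after o = p')).
  move=> y qE; rewrite (fire1 _ _ qE p0) -/e.
  suff -> : discrete (Configuration (time (c' y)) (q.1.1 :\ e)%SET
      (fun f => (q.1.2 f + (f == e))%N)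
      (apply_event (U y) e (q.1.2 e) (current (c' y)))) = after (rt y) by [].
  rewrite /discrete /after /=; congr (_, _, _).
  have zE : (current (c' y)).1.1 = q.2 by rewrite -qE.
  by rewrite /rt; case: (e) => k /=; apply: eq_from_tnth => i;
    rewrite !tnth_mktuple /jobs/= zE.
- apply: (measurable_fun_pieces mD) => q; exists (fun y => time (c' y)) => // y qE.
  have [p0|p0] := boolP (q.1.1 == finset.set0); first by rewrite (fire0 _ _ qE p0).
  by rewrite (fire1 _ _ qE p0).
- apply: (measurable_fun_pieces mD) => q.
  have [p0|p0] := boolP (q.1.1 == finset.set0).
    by exists (fun y => clock (current (c' y)) f) => // y qE; rewrite (fire0 _ _ qE p0).
  set e := tie N q.1.1.
  exists (fun y => if f == e then input (U y) e (q.1.2 e) else clock (current (c' y)) f).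
    by case: (f == e).
  by move=> y qE; rewrite (fire1 _ _ qE p0)/= clock_apply_event.
Qed.

Variable X0 : T -> state R K.
Hypothesis mX0 : measurable_fun setT X0.

Lemma measurable_conf_iter n : measurable_conf (fun y => conf N (U y) (X0 y) n).
Proof.
elim: n => [|n IH]; last exact: measurable_fire.
have [mza ms] := (measurable_fun_pairP _).1 mX0.
have [mz ma] := (measurable_fun_pairP _).1 mza.
have mtup d1 (T1 : measurableType d1) (g : T -> K.-tuple T1) :
    measurable_fun setT g -> forall k, measurable_fun setT (fun y => tnth (g y) k).
  by move=> /measurable_fun_tnthP gm k; exact: gm.
split => /= [p'| |f]; last 1 first.
- case: f => k; first exact: (mtup _ _ _ ma k).
  exact: (mtup _ _ _ ms k).
- apply: (@measurable_pieces _ _ unit (fun=> tt)).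
    by move=> []; rewrite (_ : [set _ | _] = setT)//; apply/seteqP; split.
  case; have [pE|pE] := pselect ((finset.set0, [ffun=> 0%N]) = p'.1).
    exists (\bigcap_(k in [set: 'I_K]) [set y | tnth (X0 y).1.1 k = tnth p'.2 k]).
      apply: fin_bigcap_measurable => // k _.
      by rewrite -[X in measurable X]setTI; exact: (mtup _ _ _ mz k measurableT [set tnth p'.2 k]).
    move=> y _; rewrite /discrete/=; split=> [<- //|h].
    case: p' pE h => p1 p2 /= <- h; congr (_, _).
    by apply: eq_from_tnth => i; exact: h.
  by exists set0 => // y _; split => // qE; apply: pE; rewrite -qE.
- exact: measurable_cst.
Qed.

End measurable_conf.

(** * Dependence on a single input *)

Section agreement.
Variables (R : realType) (J K : nat) (N : network J K).
Implicit Types (c : configuration R K) (u : inputs R K) (e f : event K).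

Lemma settle_possible c :
  (forall f, f \in pending c -> f \in possible N) ->
  forall f, f \in pending (settle N c) -> f \in possible N.
Proof.
move=> cp f; rewrite /settle; case: ifP => _; last exact: cp.
by rewrite finset.in_set => /andP[/running_possible].
Qed.

Lemma conf_possible u x n f : f \in pending (conf N u x n) -> f \in possible N.
Proof.
elim: n f => [|n IH] f /=; first by rewrite inE.
rewrite /fire; case: ifPn => _; first exact: settle_possible.
by rewrite in_setD1 => /andP[_]; exact: settle_possible.
Qed.

Lemma occurred_settle c : occurred (settle N c) = occurred c.
Proof. by rewrite /settle; case: ifP. Qed.

Definition agree_but e j u u' := (forall k n, routing u k n = routing u' k n) /\
  (forall f i, f \in possible N -> (f, i) != (e, j) -> input u f i = input u' f i).

Lemma agree_but_sym e j u u' : agree_but e j u u' -> agree_but e j u' u.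
Proof. by move=> [ur ui]; split=> *; [rewrite ur|rewrite ui]. Qed.

(** The input (e, j) is first read at the event of type e that makes
    [occurred e] exceed j. *)
Lemma conf_agree e j u u' x n : agree_but e j u u' ->
  (occurred (conf N u x n) e <= j)%N -> conf N u x n = conf N u' x n.
Proof.
move=> [ur ui]; elim: n => [//|n IH] /= le.
have le' : (occurred (conf N u x n) e <= j)%N.
  apply: leq_trans le; rewrite /fire; case: ifP => _ /=; rewrite occurred_settle//.
  by rewrite leq_addr.
rewrite -(IH le'); move: le; rewrite /fire; case: ifPn => //= p0.
set f := tie N _; rewrite occurred_settle => le; congr Configuration.
have fp : f \in possible N.
  by apply: (settle_possible (@conf_possible u x n)); exact: tie_in.
have fi : input u f (occurred (conf N u x n) f) = input u' f (occurred (conf N u x n) f).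
  apply: ui => //; apply/eqP => -[fe fj]; move: le; rewrite fe eqxx.
  by rewrite -fj -fe addn1 ltnn.
move: fi; rewrite /f; case: (tie _ _) => k /= fi; first by rewrite fi.
by rewrite fi ur.
Qed.

Lemma conf_agree_iff e j u u' x n (Q : configuration R K -> Prop) :
  agree_but e j u u' ->
  (Q (conf N u x n) /\ occurred (conf N u x n) e = j) <->
  (Q (conf N u' x n) /\ occurred (conf N u' x n) e = j).
Proof.
move=> uu'; split => -[Qc oj].
  by rewrite -(conf_agree uu') ?oj.
by rewrite -(conf_agree (agree_but_sym uu')) ?oj.
Qed.

End agreement.

(** * Independence of an input from the past *)

Section independent_input.
Variables (d : measure_display) (Omega : measurableType d) (R : realType).
Variable P : probability Omega R.
Variables (J K : nat) (N : network J K) (prim : primitives P K).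
Hypothesis hprim : primitives_assumption N prim.

Local Notation sigma := (primitive_sigma prim).

Lemma primitive_sigma_measurable i : sigma i `<=` measurable.
Proof.
case: i => [[[k n]|[k n]]|[k n]] A /= [B mB <-].
- by rewrite -[X in measurable X]setTI; exact: measurable_funPT.
- by rewrite -[X in measurable X]setTI; exact: measurable_funPT.
- apply: (@measurable_discrete _ _ (option 'I_K) (Phi prim k n) _ B) => o.
  exact: (Phi_measurable hprim).
Qed.

Lemma primitive_sigmaI i : setI_closed (sigma i).
Proof.
case: i => [[[k n]|[k n]]|[k n]] _ _ /= [B mB <-] [B' mB' <-];
  by exists (B `&` B') => //; exact: measurableI.
Qed.

Lemma primitive_sigmaT i : sigma i setT.
Proof. by case: i => [[[k n]|[k n]]|[k n]] /=; exists setT. Qed.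

Definition other_primitives i0 : set (set Omega) :=
  \bigcup_(i in primitive_domain N `\ i0) sigma i.

(* a pi-system that generates the sigma-algebra of the other primitives *)
Let rectangles i0 : set (set Omega) :=
  [set X | exists s : seq (primitive_index K), exists A : primitive_index K -> set Omega,
    [/\ uniq s, forall i, i \in s -> (primitive_domain N `\ i0) i,
        forall i, i \in s -> sigma i (A i) & X = \bigcap_(i in [set` s]) A i]].

Lemma rectanglesI i0 : setI_closed (rectangles i0).
Proof.
move=> _ _ [s [A [us sD sA ->]]] [s' [A' [us' sD' sA' ->]]].
exists (undup (s ++ s')), (fun i => (if i \in s then A i else setT) `&`
  (if i \in s' then A' i else setT)); split.
- exact: undup_uniq.
- by move=> i; rewrite mem_undup mem_cat => /orP[/sD|/sD'].
- move=> i _; apply: primitive_sigmaI.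
    by case: ifP => [/sA//|_]; exact: primitive_sigmaT.
  by case: ifP => [/sA'//|_]; exact: primitive_sigmaT.
- apply/seteqP; split => [w [wA wA'] i /=|w wAA'].
    by move=> _; split; case: ifP => // ?; [exact: wA|exact: wA'].
  by split=> i /= si; have /= := wAA' i; rewrite mem_undup mem_cat si ?orbT => -[].
Qed.

(** Mutual independence is a product rule for finite families; Dynkin's lemma
    extends it to the generated sigma-algebra. *)
Lemma other_primitives_independent i0 A B : primitive_domain N i0 ->
  sigma i0 A -> <<s other_primitives i0 >> B -> P (A `&` B) = (P A * P B)%E.
Proof.
move=> Di0 sA.
have mA : measurable A by exact: primitive_sigma_measurable sA.
have sub : other_primitives i0 `<=` rectangles i0.
  move=> X [i Di sX]; exists [:: i], (fun=> X); split => //.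
  - by move=> j; rewrite inE => /eqP ->.
  - by move=> j; rewrite inE => /eqP ->.
  - by rewrite set_cons1 bigcap_set1.
have mrect : <<s rectangles i0 >> `<=` @measurable _ Omega.
  apply: smallest_sub; first exact: sigma_algebra_measurable.
  move=> _ [s [C [_ _ sC ->]]]; apply: fin_bigcap_measurable => // i /= /sC.
  exact: primitive_sigma_measurable.
suff H : forall B, <<s rectangles i0 >> B -> P (A `&` B) = (P A * P B)%E.
  move=> sB; apply: H; move: B sB; apply: smallest_sub.
    exact: smallest_sigma_algebra.
  by move=> X /sub; exact: sub_sigma_algebra.
have stepC (X : set Omega) : measurable X -> P (A `&` X) = (P A * P X)%E ->
    P (A `&` ~` X) = (P A * P (~` X))%E.
  move=> mX PX.
  rewrite -setDE measureD//; last by rewrite (le_lt_trans (probability_le1 _ _)) ?ltry.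
  by rewrite [X in (_ - X)%E]PX probability_setC// muleBr ?fin_num_measure// ?mule1.
have stepU (F : (set Omega)^nat) : (forall n, measurable (F n)) ->
    trivIset setT F -> (forall n, P (A `&` F n) = (P A * P (F n))%E) ->
    P (A `&` \bigcup_n F n) = (P A * P (\bigcup_n F n))%E.
  move=> mF tF PF; rewrite setI_bigcupr measure_bigcup//; last 2 first.
  - by move=> i _; apply: measurableI.
  - by apply: trivIset_setIl.
  rewrite measure_bigcup// -(fineK (fin_num_measure P A mA)) -nneseriesZl//.
  by apply: eq_eseriesr => i _; rewrite fineK ?fin_num_measure//; exact: PF.
apply: (@dynkin_induction _ (g_sigma_algebraType (rectangles i0)) (rectangles i0)
  (fun B => P (A `&` B) = (P A * P B)%E)) => //.
- exact: rectanglesI.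
- by rewrite setIT probability_setT mule1.
- move=> _ [s [C [us sD sC ->]]].
  have si0 : i0 \notin s by apply/negP => /sD [_]; exact.
  pose C' i := if i == i0 then A else C i.
  have C'C i : i \in s -> C' i = C i.
    by rewrite /C'; case: eqVneq => // -> is0; rewrite is0 in si0.
  have C'0 : C' i0 = A by rewrite /C' eqxx.
  have indC' : P (\bigcap_(i in [set` i0 :: s]) C' i) = (\prod_(i <- i0 :: s) P (C' i))%E.
    apply: (prim_independent hprim) => [|i|i]; rewrite /= ?si0//.
      by rewrite inE => /predU1P[->//|/sD[]].
    by rewrite inE => /predU1P[->|is_]; rewrite ?C'0// C'C//; exact: sC.
  have indC : P (\bigcap_(i in [set` s]) C i) = (\prod_(i <- s) P (C i))%E.
    by apply: (prim_independent hprim) => // i /sD [].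
  move: indC'; rewrite bigcap_seq !big_cons C'0 -bigcap_seq.
  have -> : \bigcap_(i in [set` s]) C' i = \bigcap_(i in [set` s]) C i.
    by apply: eq_bigcapr => i /= /C'C.
  move=> ->; rewrite indC; congr (_ * _)%E.
  by rewrite !big_seq; apply: eq_bigr => i /C'C ->.
- by move=> X /mrect; exact: stepC.
- by move=> F mF; apply: stepU => n; apply: mrect; exact: mF.
Qed.

Definition primitive (e : event K) j : Omega -> R :=
  match e with inl k => Te prim k j | inr k => Ts prim k j end.

Definition primitive_id (e : event K) j : primitive_index K :=
  match e with inl k => inl (inl (k, j)) | inr k => inl (inr (k, j)) end.

Lemma primitive_id_inj e j f i :
  primitive_id f i = primitive_id e j -> (f, i) = (e, j).
Proof. by case: e => k; case: f => l //= [-> ->]. Qed.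

Lemma primitive_id_domain e j : e \in possible N -> primitive_domain N (primitive_id e j).
Proof. by rewrite inE; case: e. Qed.

Lemma measurable_primitive e j : measurable_fun setT (primitive e j).
Proof. by case: e => k; exact: measurable_funPT. Qed.

Lemma primitive_sigmaP e j (B : set R) : measurable B ->
  sigma (primitive_id e j) (primitive e j @^-1` B).
Proof. by move=> mB; case: e => k; exists B. Qed.

Lemma primitive_law e j (B : set R) : e \in possible N -> measurable B ->
  P (primitive e j @^-1` B) = P (primitive e 0 @^-1` B).
Proof.
rewrite inE; case: e => k kN mB /=; first exact: (Te_identical hprim).
exact: (Ts_identical hprim).
Qed.

(** Events of the configuration, stated so that they can be used for every
    source of [measurable_conf]. *)
Definition observable (Q : configuration R K -> Prop) : Prop :=
  forall d (T : measurableType d) (c : T -> configuration R K),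
    measurable_conf c -> measurable [set y | Q (c y)].

Variables lambda m : 'cV[R]_K.
Local Notation real := (realization prim lambda m).

Definition scale (e : event K) : R :=
  match e with inl k => (lambda k 0)^-1 | inr k => m k 0 end.

Lemma input_realization e j w : input (real w) e j = scale e * primitive e j w.
Proof. by case: e. Qed.

(** The primitive (e, j) and the arrivals to classes without external arrivals
    are set to 0, which makes the dynamics measurable for the other primitives. *)
Definition mask (e : event K) j (w : Omega) : inputs R K :=
  let keep f i := (f \in possible N) && ((f, i) != (e, j)) in
  Inputs (fun k i => if keep (inl k) i then input (real w) (inl k) i else 0)
         (fun k i => if keep (inr k) i then input (real w) (inr k) i else 0)
         (fun k i => Phi prim k i w).

Lemma agree_mask e j w : agree_but N e j (real w) (mask e j w).
Proof. by split => // -[k|k] i fp fe; rewrite /mask /= fp fe. Qed.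

Section mask_measurable.
Variables (e : event K) (j : nat) (x : state R K).
Let T := g_sigma_algebraType (other_primitives (primitive_id e j)).

Lemma measurable_conf_mask n :
  measurable_conf (fun w : T => conf N (mask e j w) x n).
Proof.
have other i A : primitive_domain N i -> i != primitive_id e j -> sigma i A ->
    measurable (A : set T).
  move=> Di ie sA; apply: sub_sigma_algebra; exists i => //; split => //.
  by move/eqP: ie.
have mkeep f i : measurable_fun setT (fun w : T =>
    if (f \in possible N) && ((f, i) != (e, j)) then input (real w) f i else 0).
  case: (boolP ((f \in possible N) && ((f, i) != (e, j)))) => [/andP[fp fe]|_];
    last exact: measurable_cst.
  under eq_fun do rewrite input_realization.
  apply: measurable_funM; first exact: measurable_cst.
  move=> _ B mB; rewrite setTI; apply: (other (primitive_id f i)).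
  - exact: primitive_id_domain.
  - by apply: contra fe => /eqP /primitive_id_inj ->.
  - exact: primitive_sigmaP.
apply: (@measurable_conf_iter _ _ _ N _ T (mask e j) _ _ (fun=> x)).
- by case=> k i; exact: mkeep.
- move=> k i o; apply: (other (inr (k, i))) => //.
  + by case: (e).
  + by exists [set o].
- exact: measurable_cst.
Qed.

End mask_measurable.

Lemma measurable_conf_realization x n :
  measurable_conf (fun w => conf N (real w) x n).
Proof.
apply: (@measurable_conf_iter _ _ _ N _ Omega real _ _ (fun=> x)).
- move=> e j; under eq_fun do rewrite input_realization.
  by apply: measurable_funM; [exact: measurable_cst|exact: measurable_primitive].
- by move=> k i o; exact: (Phi_measurable hprim).
- exact: measurable_cst.
Qed.

Lemma observable_occurred e j : observable (fun c => occurred c e = j).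
Proof.
move=> d' T c [mD _ _].
have := measurable_discrete mD (fun q => q.1.2 e = j).
by congr measurable; apply/funext => y; rewrite /= ffunE.
Qed.

Lemma observableI Q Q' : observable Q -> observable Q' ->
  observable (fun c => Q c /\ Q' c).
Proof. by move=> oQ oQ' d' T c mc; apply: measurableI; [exact: oQ|exact: oQ']. Qed.

(** The index of the next input of type e is random.  On the event that it is
    j, the configuration is also that of the dynamics with input (e, j) masked,
    hence independent of that input; all inputs of type e have the same law. *)
Lemma fresh_input x n e (Q : configuration R K -> Prop) (B : set R) :
  e \in possible N -> observable Q -> measurable B ->
  P [set w | Q (conf N (real w) x n) /\
             B (primitive e (occurred (conf N (real w) x n) e) w)] =
  (P (primitive e 0 @^-1` B) * P [set w | Q (conf N (real w) x n)])%E.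
Proof.
move=> ep oQ mB.
pose E j := [set w | Q (conf N (real w) x n) /\ occurred (conf N (real w) x n) e = j].
have oE j := observableI oQ (@observable_occurred e j).
have mE j : measurable (E j) by exact: oE (measurable_conf_realization x n).
have tE : trivIset setT E.
  apply/trivIsetP => i j _ _ /eqP ij; apply/seteqP; split => // w [[_ oi] [_ oj]].
  by apply: ij; rewrite -oi -oj.
have -> : [set w | Q (conf N (real w) x n)] = \bigcup_j E j.
  apply/seteqP; split => w; last by move=> [j _ []].
  by move=> Qw; exists (occurred (conf N (real w) x n) e).
have -> : [set w | Q (conf N (real w) x n) /\
    B (primitive e (occurred (conf N (real w) x n) e) w)] =
    \bigcup_j (primitive e j @^-1` B `&` E j).
  apply/seteqP; split => w /=; last by move=> [j _ [/= Bw [Qw oj]]]; rewrite oj.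
  by move=> [Qw Bw]; exists (occurred (conf N (real w) x n) e).
have mp j : measurable (primitive e j @^-1` B).
  by rewrite -[X in measurable X]setTI; exact: measurable_primitive.
rewrite measure_bigcup//; last 2 first.
- by move=> j _; exact: measurableI.
- exact: trivIset_setIl.
rewrite measure_bigcup// -(fineK (fin_num_measure P _ (mp 0%N))) -nneseriesZl//.
apply: eq_eseriesr => j _; rewrite fineK ?fin_num_measure//.
transitivity (P (primitive e j @^-1` B) * P (E j))%E; last first.
  by congr (_ * _)%E; exact: primitive_law.
apply: (@other_primitives_independent (primitive_id e j)).
- exact: primitive_id_domain.
- exact: primitive_sigmaP.
- rewrite (_ : E j = [set w | Q (conf N (mask e j w) x n) /\
      occurred (conf N (mask e j w) x n) e = j]).
    exact: oE (measurable_conf_mask e j x n).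
  by apply/seteqP; split => w; apply conf_agree_iff;
    [exact/agree_but_sym/agree_mask|exact: agree_mask].
Qed.

End independent_input.

(** * Integration *)

Lemma measurable_true d (T : measurableType d) (b : T -> bool) :
  measurable_fun setT b -> measurable [set y | b y].
Proof.
by move=> mb; have := mb measurableT [set true] I; rewrite setTI.
Qed.

Section monotone_integral.
Import HBNNSimple.
Local Open Scope ereal_scope.

(** Neither function has to be measurable: the integral of a nonnegative
    function is a supremum over simple functions below it, and these can be cut
    off outside S. *)
Lemma le_integral_on d (T : measurableType d) (R : realType)
    (mu : {measure set T -> \bar R}) (S : set T) (f g : T -> \bar R) :
  measurable S -> mu (~` S) = 0 -> (forall x, 0 <= f x) -> (forall x, 0 <= g x) ->
  (forall x, S x -> f x <= g x) -> \int[mu]_x f x <= \int[mu]_x g x.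
Proof.
move=> mS S0 f0 g0 fg; rewrite !ge0_integralTE//.
apply: ge_ereal_sup => _ [h /= hf <-].
apply: le_ereal_sup_tmp; exists (sintegral mu (proj_nnsfun h mS)).
  exists (proj_nnsfun h mS) => // x /=; rewrite mindicE.
  case: (boolP (x \in S)) => [|_]; last by rewrite mulr0.
  by rewrite inE mulr1 => Sx; apply: le_trans (hf x) (fg x Sx).
rewrite -!integralT_nnsfun.
rewrite (@ge0_negligible_integral _ _ _ mu setT (~` S))//; last 3 first.
- exact: measurableC.
- exact/measurable_EFinP/measurable_funPT.
- by move=> x _; rewrite lee_fin.
rewrite [leRHS](@ge0_negligible_integral _ _ _ mu setT (~` S))//; last 3 first.
- exact: measurableC.
- exact/measurable_EFinP/measurable_funPT.
- by move=> x _; rewrite lee_fin.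
rewrite setTD setCK le_eqVlt; apply/orP; left.
apply/eqP/eq_integral => x; rewrite inE => Sx /=.
by rewrite mindicE mem_set// mulr1.
Qed.

Lemma eq_integral_on d (T : measurableType d) (R : realType)
    (mu : {measure set T -> \bar R}) (S : set T) (f g : T -> \bar R) :
  measurable S -> mu (~` S) = 0 -> (forall x, 0 <= f x) -> (forall x, 0 <= g x) ->
  (forall x, S x -> f x = g x) -> \int[mu]_x f x = \int[mu]_x g x.
Proof.
move=> mS S0 f0 g0 fg; apply/eqP; rewrite eq_le; apply/andP; split;
  by apply: (le_integral_on mS) => // x /fg ->.
Qed.

End monotone_integral.

Section state_measurable.
Variables (R : realType) (J K : nat) (N : network J K).

Lemma measurable_clock e : measurable_fun setT (fun x : state R K => clock x e).
Proof.
case: e => k /=.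
  apply: (measurableT_comp (f := fun z : K.-tuple R => tnth z k)).
    exact: measurable_tnth.
  exact: measurableT_comp.
by apply: (measurableT_comp (f := fun z : K.-tuple R => tnth z k));
  first exact: measurable_tnth.
Qed.

Lemma measurable_jobs l : measurable_fun setT (fun x : state R K => jobs x l).
Proof.
apply: (measurableT_comp (f := fun z : K.-tuple nat => tnth z l)).
  exact: measurable_tnth.
exact: measurableT_comp.
Qed.

Lemma measurable_state_space : measurable (state_space N : set (state R K)).
Proof.
rewrite (_ : state_space N = \bigcap_(k in [set: 'I_K])
   ([set x : state R K | 0 <= clock x (inl k)] `&` [set x : state R K | 0 <= clock x (inr k)]
   `&` [set x : state R K | k \notin external N -> clock x (inl k) = 0])); last first.
  apply/seteqP; split => x /= Sx k; first by move=> _; have [] := Sx k.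
  by have [[]] := Sx k I.
apply: fin_bigcap_measurable => // k _.
have ge e : measurable [set x : state R K | 0 <= clock x e].
  apply: measurable_true; apply: measurable_fun_ler => //.
  exact: measurable_clock.
apply: measurableI; first exact: measurableI.
case: (boolP (k \in external N)) => kN.
  by rewrite (_ : [set _ | _] = setT)//; apply/seteqP; split.
rewrite (_ : [set _ | _] = [set x : state R K | clock x (inl k) == 0]).
  apply: measurable_true; apply: measurable_fun_eqr => //.
  exact: measurable_clock.
by apply/seteqP; split => x /= h; [apply/eqP/h|move=> _; exact/eqP].
Qed.

Lemma measurable_advance d (T : measurableType d) (h : T -> R)
    (c : T -> configuration R K) : measurable_fun setT h -> measurable_conf c ->
  measurable_fun setT (fun y => advance N (h y) (current (c y))).
Proof.
move=> mh [mD mt mk].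
apply: (measurable_fun_pieces mD) => q.
exists (fun y => (q.2,
   [tuple clock (current (c y)) (inl k) - h y *+ (inl k \in running N (at_jobs R q.2)) | k < K],
   [tuple clock (current (c y)) (inr k) - h y *+ (inr k \in running N (at_jobs R q.2)) | k < K])).
  have mtup e : measurable_fun setT (fun y => clock (current (c y)) e
      - h y *+ (e \in running N (at_jobs R q.2))).
    apply: measurable_funB => //.
    by case: (e \in _); [exact: mh|exact: measurable_cst].
  apply: measurable_fun_pair.
    apply: measurable_fun_pair; first exact: measurable_cst.
    apply/measurable_fun_tnthP => k; rewrite (_ : _ \o _ = fun y =>
      clock (current (c y)) (inl k) - h y *+ (inl k \in running N (at_jobs R q.2)))//.
    by apply/funext => y /=; rewrite tnth_mktuple.
  apply/measurable_fun_tnthP => k; rewrite (_ : _ \o _ = fun y =>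
    clock (current (c y)) (inr k) - h y *+ (inr k \in running N (at_jobs R q.2)))//.
  by apply/funext => y /=; rewrite tnth_mktuple.
move=> y <-; rewrite /advance; congr (_, _, _); apply: eq_from_tnth => k;
  by rewrite !tnth_mktuple.
Qed.

End state_measurable.

(** Tonelli's theorem for the graph of a family of events indexed by the times
    in [0, 1): integrate over time last. *)
Lemma product_lebesgue_le d (T : measurableType d) (R : realType)
    (m1 : probability T R) (W : set (T * R)) (b : \bar R) : measurable W ->
  (0 <= b)%E -> (forall y s, W (y, s) -> 0 <= s < 1) ->
  (forall s, 0 <= s < 1 -> (m1 (ysection W s) <= b)%E) ->
  ((m1 \x @lebesgue_measure R) W <= b)%E.
Proof.
move=> mW b0 W01 Wb.
have -> : ((m1 \x @lebesgue_measure R) W = (m1 \x^ @lebesgue_measure R) W)%E.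
  by apply: product_measure_unique => // A B mA mB; exact: product_measure2E.
rewrite /product_measure2.
apply: (@le_trans _ _
  (\int[@lebesgue_measure R]_s (b * (\1_(`[0, 1[%classic) s)%:E)))%E; last first.
  rewrite ge0_integralZl//; last exact/measurable_EFinP/measurable_indic.
  have leb1 : lebesgue_measure (`[0%R, 1%R[%classic : set R) = 1%E.
    by rewrite lebesgue_measure_itv/= lte01 oppr0 adde0.
  by rewrite integral_indic// setIT [X in (_ * X)%E]leb1 mule1.
apply: ge0_le_integral => //.
- exact: measurable_fun_ysection.
- by apply: measurable_funeM; exact/measurable_EFinP/measurable_indic.
move=> s _ /=; rewrite indicE; have [s01|s01] := pselect (0 <= s < 1).
  by rewrite mem_set ?mule1 ?Wb//= in_itv.
rewrite memNset; last by rewrite /= in_itv.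
rewrite mule0 (_ : ysection _ s = set0) ?measure0//.
by apply/seteqP; split => y //=; rewrite /ysection /= inE => /W01.
Qed.

Lemma observableT (R : realType) (J K : nat) (N : network J K)
    (Q : configuration R K -> Prop) :
  observable Q -> observable (fun c => Q (settle N c)).
Proof. by move=> oQ d T c mc; exact: (oQ _ _ _ (measurable_settle N mc)). Qed.

Lemma lebesgue_measure_mono (R : realType) (A B : set R) :
  measurable A -> measurable B -> A `<=` B ->
  (@lebesgue_measure R A <= @lebesgue_measure R B)%E.
Proof.
by move=> mA mB AB; exact: (le_measure lebesgue_measure (mem_set mA) (mem_set mB) AB).
Qed.

Lemma measurable_potential (R : realType) (K : nat) e l c0 w a :
  measurable_fun setT (fun x : state R K => potential e l c0 w a x).
Proof.
apply: measurable_funM.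
  apply: (measurableT_comp (f := ramp R c0 w)) => //; exact: measurable_jobs.
apply: (measurableT_comp (f := clamp a)); last exact: measurable_clock.
apply: measurable_maxr => //; apply: measurable_minr => //.
exact: measurable_funM.
Qed.

(** * The stationary network

    The sample space of a network started from pi is the product of the state
    space and the space of the primitives. *)

Section stationary_network.
Variables (d : measure_display) (Omega : measurableType d) (R : realType).
Variable P : probability Omega R.
Variables (J K : nat) (N : network J K) (prim : primitives P K).
Hypothesis hprim : primitives_assumption N prim.
Variables lambda m : 'cV[R]_K.
Hypothesis lambda_gt0 : forall k, k \in external N -> 0 < lambda k 0.
Hypothesis m_gt0 : forall k, 0 < m k 0.
Hypothesis external_neq0 : external N != finset.set0.
Variable pi : probability (state R K) R.
Hypothesis st : stationary N prim lambda m pi.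

Local Notation real := (realization prim lambda m).
Local Notation mu := (pi \x P)%E.
Local Notation S := (state_space N).
Local Notation cf y n := (conf N (real y.2) y.1 n).
Local Notation t y n := (time (cf y n)).
Implicit Types (e f : event K) (y : state R K * Omega).

Lemma scale_gt0 e : e \in possible N -> 0 < scale lambda m e.
Proof. by rewrite inE; case: e => k //= kN; rewrite invr_gt0 lambda_gt0. Qed.

Lemma primitive_ge0 e j w : e \in possible N -> 0 <= primitive prim e j w.
Proof.
rewrite inE; case: e => k kN /=; first exact: (Te_ge0 hprim).
exact: (Ts_ge0 hprim).
Qed.

Lemma realization_ge0 w e j : e \in possible N -> 0 <= input (real w) e j.
Proof.
by move=> ep; rewrite input_realization mulr_ge0 ?primitive_ge0// ltW ?scale_gt0.
Qed.

Lemma measurable_conf_joint n : measurable_conf (fun y => cf y n).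
Proof.
apply: (@measurable_conf_iter _ _ _ N _ _ (fun y : state R K * Omega => real y.2) _ _ fst).
- move=> f i; under eq_fun do rewrite input_realization.
  apply: measurable_funM; first exact: measurable_cst.
  apply: (measurableT_comp (f := primitive prim f i)) => //.
  exact: measurable_primitive.
- move=> k i o; rewrite -[X in measurable X]setTI.
  exact: (@measurable_snd _ _ (state R K) Omega measurableT _ (Phi_measurable hprim k i o)).
- exact: measurable_fst.
Qed.

Lemma measurable_time n : measurable_fun setT (fun y => t y n).
Proof. by have [] := measurable_conf_joint n. Qed.

Lemma measurable_fst_space : measurable [set y : state R K * Omega | S y.1].
Proof.
rewrite -[X in measurable X]setTI.
exact: (@measurable_fst _ _ (state R K) Omega measurableT _ (measurable_state_space N)).
Qed.

Lemma space_null : pi (~` S) = 0%E.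
Proof.
rewrite probability_setC; last exact: measurable_state_space.
by rewrite st.1 subee.
Qed.

Lemma fst_space_null : mu (~` [set y | S y.1]) = 0%E.
Proof.
have mu1 : mu [set y | S y.1] = 1%E.
  rewrite (_ : [set y | S y.1] = S `*` setT); last first.
    by apply/seteqP; split => y //= -[].
  transitivity (pi S * P setT)%E; last by rewrite st.1 probability_setT mule1.
  by apply: product_measure1E => //; exact: measurable_state_space.
rewrite probability_setC; last exact: measurable_fst_space.
by rewrite [X in (1 - X)%E]mu1 subee.
Qed.

Definition clocked n s : set (state R K * Omega) := [set y | t y n <= s < t y n.+1].

Lemma measurable_clocked n s : measurable (clocked n s).
Proof.
have -> : clocked n s = [set y | t y n <= s] `&` [set y | s < t y n.+1].
  by apply/seteqP; split => y /=; [move/andP|move=> h; apply/andP].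
apply: measurableI; apply: measurable_true.
  by apply: measurable_fun_ler => //; exact: measurable_time.
by apply: measurable_fun_ltr => //; exact: measurable_time.
Qed.

(** Only from a legal initial state, where times increase, does the defining
    property of the process single out one configuration; elsewhere the process
    need not be measurable, so it is replaced there by the initial state. *)
Definition legal_process s y : state R K :=
  if `[< S y.1 >] then X N prim lambda m s y else y.1.

Lemma measurable_legal_process s : measurable_fun setT (legal_process s).
Proof.
pose A (c : option (option nat)) : set (state R K * Omega) :=
  match c with
  | None => ~` [set y | S y.1]
  | Some None => [set y | S y.1] `&` \bigcap_n ~` clocked n s
  | Some (Some n) => [set y | S y.1] `&` clocked n s
  end.
apply: (@measurable_fun_cover _ _ _ _ _ A).
- move=> [[n|]|] /=.
  + by apply: measurableI; [exact: measurable_fst_space|exact: measurable_clocked].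
  + apply: measurableI; first exact: measurable_fst_space.
    by apply: bigcap_measurableType => n _; apply: measurableC; exact: measurable_clocked.
  + by apply: measurableC; exact: measurable_fst_space.
- move=> y; have [Sy|Sy] := pselect (S y.1); last by exists None.
  have [[n ny]|ny] := pselect (exists n, clocked n s y); first by exists (Some (Some n)).
  by exists (Some None); split => // n _ /= ?; apply: ny; exists n.
- move=> [[n|]|] /=.
  + exists (fun y => advance N (s - t y n) (current (cf y n))).
      apply: measurable_advance; last exact: measurable_conf_joint.
      by apply: measurable_funB => //; exact: measurable_time.
    move=> y [Sy ny]; rewrite /legal_process asboolT// /X.
    by apply: (process_in external_neq0) => // f i; exact: realization_ge0.
  + exists (fun y => advance N s (current (cf y 0))).
      by apply: measurable_advance => //; exact: measurable_conf_joint.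
    move=> y [Sy ny]; rewrite /legal_process asboolT// /X.
    apply: (process_out external_neq0) => // [f i|n]; first exact: realization_ge0.
    by apply/negP; exact: ny.
  + by exists fst; [exact: measurable_fst|move=> y Sy; rewrite /legal_process asboolF].
Qed.

(** Stationarity is about the law of the unmodified process, whose preimages
    need not be measurable; [eq_integral_on] compares the two laws section by
    section. *)
Lemma legal_process_law s B : 0 <= s -> measurable B ->
  mu (legal_process s @^-1` B) = pi B.
Proof.
move=> s0 mB; rewrite -(st.2 s s0 B mB) /product_measure1.
apply: (eq_integral_on (measurable_state_space N) space_null) => x.
- exact: measure_ge0.
- exact: measure_ge0.
move=> Sx /=; congr (P _); rewrite /xsection; apply/seteqP.
by split=> w /=; rewrite !inE /= /legal_process asboolT.
Qed.

(** The threshold is half the mean of the primitives. *)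
Definition long : set R := [set z | 2^-1 <= z].

Lemma measurable_long : measurable long.
Proof. by apply: measurable_true; apply: measurable_fun_ler. Qed.

(** Otherwise the primitive would be at most 1/2 almost surely, against its
    mean 1. *)
Lemma primitive_tail e : e \in possible N -> (0 < P (primitive prim e 0 @^-1` long))%E.
Proof.
move=> ep; rewrite lt0e measure_ge0 andbT; apply/negP => /eqP p0.
have mp : measurable_fun setT (EFin \o primitive prim e 0).
  by apply/measurable_EFinP; exact: measurable_primitive.
have : (\int[P]_w (primitive prim e 0 w)%:E <= \int[P]_w (2^-1)%:E)%E.
  apply: ae_ge0_le_integral => //.
  - by move=> w _; rewrite lee_fin primitive_ge0.
  - exists (primitive prim e 0 @^-1` long); split => //.
    + rewrite -[X in measurable X]setTI.
      by apply: measurable_primitive => //; exact: measurable_long.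
    + by move=> w /= /not_implyP [_ /negP]; rewrite lee_fin -ltNge; exact: ltW.
have -> : (\int[P]_w (2^-1)%:E)%E = (2^-1)%:E :> \bar R.
  transitivity ((2^-1)%:E * P setT)%E; first exact: integral_cst.
  by rewrite probability_setT mule1.
have -> : (\int[P]_w (primitive prim e 0 w)%:E)%E = 1%E.
  move: ep; rewrite inE; case: e {p0 mp} => k kN.
    by rewrite -(Te_mean hprim kN) unlock.
  by rewrite -(Ts_mean hprim k) unlock.
rewrite lee_fin; lra.
Qed.

Definition short_from f v : set Omega :=
  [set w | forall i, (v <= i)%N -> ~ long (primitive prim f i w)].

Lemma short_from_null f v : f \in possible N ->
  measurable (short_from f v) /\ P (short_from f v) = 0%E.
Proof.
move=> fp; set W := short_from f v.
have mp i : measurable (primitive prim f i @^-1` long).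
  rewrite -[X in measurable X]setTI.
  by apply: measurable_primitive => //; exact: measurable_long.
have mlt i : measurable (primitive prim f i @^-1` (~` long)).
  exact: measurableC (mp i).
have mW : measurable W.
  rewrite (_ : W = \bigcap_(i in [set i | (v <= i)%N])
     (primitive prim f i @^-1` (~` long))) //.
  by apply: bigcap_measurableType => i _; exact: mlt.
set q := fine (P (primitive prim f 0 @^-1` (~` long))).
have q1 : `|q| < 1.
  rewrite ger0_norm ?fine_ge0// -lte_fin fineK ?fin_num_measure//.
  rewrite (_ : _ @^-1` _ = ~` (primitive prim f 0 @^-1` long))//.
  rewrite probability_setC// lteBlDr ?fin_num_measure//.
  by rewrite -[ltLHS]adde0 lteD2lE// primitive_tail.
split => //; have Wq n : fine (P W) <= q ^+ n.
  pose A (i : primitive_index K) : set Omega := match i with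
    | inl (inl (k, j)) => primitive prim (inl k) j @^-1` (~` long)
    | inl (inr (k, j)) => primitive prim (inr k) j @^-1` (~` long)
    | _ => setT end.
  have AE i : A (primitive_id f i) = primitive prim f i @^-1` (~` long).
    by case: (f).
  pose s := [seq primitive_id f i | i <- iota v n].
  have us : uniq s.
    by rewrite map_inj_uniq ?iota_uniq// => i j /primitive_id_inj [].
  have := prim_independent hprim us.
  have sD i : i \in s -> primitive_domain N i.
    by move=> /mapP[j _ ->]; exact: primitive_id_domain.
  have sA i : i \in s -> primitive_sigma prim i (A i).
    move=> /mapP[j _ ->]; rewrite AE; apply: primitive_sigmaP.
    by apply: measurableC; exact: measurable_long.
  move=> /(_ sD A sA) PA.
  rewrite -lee_fin fineK ?fin_num_measure//.
  apply: (@le_trans _ _ (P (\bigcap_(i in [set` s]) A i))).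
    apply: le_measure; rewrite ?inE//.
      apply: fin_bigcap_measurable => // i /= /mapP[j _ ->]; rewrite AE; exact: mlt.
    move=> w Ww i /= /mapP[j]; rewrite mem_iota => /andP[vj _] ->.
    by rewrite AE; exact: Ww.
  rewrite PA big_map (eq_bigr (fun=> q%:E)); last first.
    move=> i _; rewrite AE /q fineK ?fin_num_measure//.
    apply: (primitive_law hprim) => //.
    by apply: measurableC; exact: measurable_long.
  rewrite big_const_seq count_predT size_iota.
  suff -> : iter n ( *%E q%:E) 1%E = (q ^+ n)%:E by [].
  by elim: (n) => //= k ->; rewrite exprS EFinM.
have /cvg_expr qn := q1.
apply/eqP; rewrite eq_le measure_ge0 andbT -[leLHS]fineK ?fin_num_measure// lee_fin.
have <- := cvg_lim (@Rhausdorff R) qn.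
by apply: limr_ge; [apply/cvg_ex; exists 0|exact: nearW].
Qed.
(** If one type of event had all partial sums of its inputs bounded, its inputs
    would be short from some index on. *)
Lemma explosion_null : exists Z : set Omega, [/\ measurable Z, P Z = 0%E &
  forall y, S y.1 -> (forall n, t y n <= 1) -> Z y.2].
Proof.
pose F n := if unpickle n is Some (f, v) then
  if f \in possible N then short_from f v else set0 else set0.
have mF n : measurable (F n).
  rewrite /F; case: unpickle => [[f v]|]; last exact: measurable0.
  by case: ifP => [/(short_from_null v)[]|_]; last exact: measurable0.
have mU : measurable (\bigcup_n F n) by apply: bigcupT_measurable.
exists (\bigcup_n F n); split => //.
  apply: measure_negligible => //; apply: negligible_bigcup => n.
  apply/negligibleP; first exact: mF.
  rewrite /F; case: unpickle => [[f v]|]; last exact: measure0.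
  by case: ifP => [/(short_from_null v)[]|_]; last exact: measure0.
move=> y Sy t1.
have ige f i : f \in possible N -> 0 <= input (real y.2) f i.
  exact: realization_ge0.
have [f fp sum1] := explosion external_neq0 ige Sy t1.
have [v vP] : exists v, short_from f v y.2.
  apply: contrapT => /forallNP nv.
  have nl v : exists2 i, (v <= i)%N & long (primitive prim f i y.2).
    apply: contrapT => ni; apply: (nv v) => i vi li; apply: ni; by exists i.
  have c0 : 0 < scale lambda m f / 2 by rewrite divr_gt0// scale_gt0.
  have big k : exists n, k%:R * (scale lambda m f / 2) <= \sum_(0 <= i < n) input (real y.2) f i.
    elim: k => [|k [n IH]]; first by exists 0%N; rewrite mul0r big_geq.
    have [i ni li] := nl n; exists i.+1; rewrite big_nat_recr//=.
    rewrite -natr1 mulrDl mul1r; apply: lerD.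
      apply: le_trans IH _; rewrite (@big_cat_nat _ _ _ n 0%N i)//= lerDl.
      by apply: sumr_ge0 => j _; exact: ige.
    by rewrite input_realization ler_pM2l// scale_gt0.
  have [n nP] := big (Num.truncn (scale lambda m f / 2)^-1).+1.
  have := le_trans nP (sum1 n); apply/negP; rewrite -ltNge.
  by rewrite -ltr_pdivrMr// mul1r truncnS_gt.
exists (pickle (f, v)) => //; by rewrite /F pickleK fp.
Qed.

Lemma observable_discrete (Q : {set event K} * {ffun event K -> nat} * K.-tuple nat -> Prop) :
  @observable R K (fun c => Q (discrete c)).
Proof. by move=> d' T c [mD _ _]; exact: measurable_discrete. Qed.

Lemma observable_jobs l c : @observable R K (fun q => (c < jobs (current q) l)%N).
Proof. exact: (observable_discrete (fun q => (c < tnth q.2 l)%N)). Qed.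

(** A predicate of the configuration before the event.  Events at time 0 are
    included, so that the balance can start from the initial state. *)
Definition occurs e l (c : nat) (q : configuration R K) : Prop :=
  [/\ tie N (pending (settle N q)) = e,
      ((if pending (settle N q) == finset.set0 then +oo
        else (time (settle N q))%:E) <= 1)%E &
      (c < jobs (current q) l)%N].

Lemma observable_occurs e l c : observable (occurs e l c).
Proof.
have o1 : observable (fun q : configuration R K =>
    tie N (pending (settle N q)) = e /\ pending (settle N q) <> finset.set0).
  apply: (@observableT _ _ _ N (fun q => tie N (pending q) = e /\ pending q <> finset.set0)).
  exact: (@observable_discrete (fun q => tie N q.1.1 = e /\ q.1.1 <> finset.set0)).
have o2 : observable (fun q : configuration R K => time (settle N q) <= 1).
  apply: (@observableT _ _ _ N (fun q => time q <= 1)) => d' T q [_ mt _].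
  by apply: measurable_true; apply: measurable_fun_ler.
move=> d' T q mq.
have := observableI (observableI o1 o2) (@observable_jobs l c) mq.
congr measurable; apply/seteqP; split => y /=.
  by move=> [[[te p0] t1] lc]; split => //; rewrite ifF//; apply/eqP.
by move=> [te]; case: eqP => // p0; rewrite lee_fin.
Qed.

Lemma measurable_occurs e l c n : measurable [set y | occurs e l c (cf y n)].
Proof. by apply: observable_occurs; exact: measurable_conf_joint. Qed.

Definition long_occurs e l c n : set (state R K * Omega) :=
  [set y | occurs e l c (cf y n) /\
           long (primitive prim e (occurred (cf y n) e) y.2)].

Lemma measurable_long_occurs e l c n : measurable (long_occurs e l c n).
Proof.
rewrite (_ : long_occurs e l c n = \bigcup_j ([set y | occurs e l c (cf y n)] `&`
  [set y | occurred (cf y n) e = j] `&` (primitive prim e j \o snd) @^-1` long)); last first.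
  apply/seteqP; split => y; last first.
    by case=> j _ [[oc oj] lj]; split => //; rewrite oj.
  by move=> [oc lo]; exists (occurred (cf y n) e).
apply: bigcupT_measurable => j; apply: measurableI; first apply: measurableI.
- exact: measurable_occurs.
- exact: (@observable_occurred _ _ e j _ _ _ (measurable_conf_joint n)).
- rewrite -[X in measurable X]setTI; apply: measurableT_comp => //.
    exact: measurable_primitive.
  exact: measurable_long.
Qed.

(** [fresh_input], integrated over the initial state. *)
Lemma long_occurs_measure e l c n : e \in possible N ->
  mu (long_occurs e l c n) =
  (P (primitive prim e 0 @^-1` long) * mu [set y | occurs e l c (cf y n)])%E.
Proof.
move=> ep.
transitivity (\int[pi]_x (P (primitive prim e 0 @^-1` long)
   * P (xsection [set y | occurs e l c (cf y n)] x)))%E; last first.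
  rewrite ge0_integralZl//; apply: measurable_fun_xsection.
  exact: measurable_occurs.
apply: eq_integral => x _.
have := fresh_input hprim lambda m x n ep (@observable_occurs e l c) measurable_long.
rewrite (_ : xsection [set y | occurs e l c (cf y n)] x =
  [set w | occurs e l c (conf N (real w) x n)]); last first.
  by rewrite /xsection; apply/seteqP; split => w /=; rewrite inE.
move=> <-; congr (P _).
by rewrite /xsection; apply/seteqP; split => w /=; rewrite inE.
Qed.

Definition crowded l (c : nat) s : set (state R K * Omega) :=
  [set y | S y.1 /\ exists2 n, clocked n s y & (c < jobs (current (cf y n)) l)%N].

Definition crowded_graph l c : set ((state R K * Omega) * R) :=
  [set z | 0 <= z.2 < 1 /\ crowded l c z.2 z.1].

Lemma measurable_crowded_graph l c : measurable (crowded_graph l c).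
Proof.
rewrite (_ : crowded_graph l c = snd @^-1` `[0, 1[ `&` (fst @^-1` [set y | S y.1] `&`
  \bigcup_n ([set z | t z.1 n <= z.2] `&` [set z | z.2 < t z.1 n.+1] `&`
    fst @^-1` [set y | (c < jobs (current (cf y n)) l)%N]))); last first.
  apply/seteqP; split => -[y s]; rewrite /crowded_graph /=.
    move=> [s01 [Sy [n /andP[n1 n2] lc]]]; split; first by rewrite in_itv.
    by split => //; exists n.
  move=> [s01 [Sy [n _ [[/= n1 n2] lc]]]]; split; first by rewrite in_itv in s01.
  by split => //; exists n => //; apply/andP.
have pre d1 d2 (T1 : measurableType d1) (T2 : measurableType d2) (g : T1 -> T2) B :
    measurable_fun setT g -> measurable B -> measurable (g @^-1` B).
  by move=> mg mB; rewrite -[X in measurable X]setTI; exact: mg.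
have mt n : measurable_fun setT (fun z : (state R K * Omega) * R => t z.1 n).
  by apply: (measurableT_comp (f := fun y => t y n)) => //; exact: measurable_time.
apply: measurableI; first by apply: pre.
apply: measurableI.
  by apply: pre => //; exact: measurable_fst_space.
apply: bigcupT_measurable => n; apply: measurableI; first apply: measurableI.
- by apply: measurable_true; apply: measurable_fun_ler.
- by apply: measurable_true; apply: measurable_fun_ltr.
- apply: pre => //.
  by apply: (@observable_jobs l c); exact: measurable_conf_joint.
Qed.

Local Notation leb := (@lebesgue_measure R).

(** The left-hand side is the expected time spent in [0, 1) with more than c
    jobs of class l; the right-hand side bounds the probability of this at each
    fixed time. *)
Lemma crowded_graph_measure l c :
  ((mu \x leb) (crowded_graph l c) <= pi [set x | (c < jobs x l)%N])%E.
Proof.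
have mW := measurable_crowded_graph l c.
have mB : measurable [set x : state R K | (c < jobs x l)%N].
  have := @measurable_jobs R K l measurableT [set z | (c < z)%N] I.
  by rewrite setTI.
apply: (@product_lebesgue_le _ _ _ [the probability _ _ of mu]) => //.
  by move=> y s [].
move=> s s01.
have s0 : 0 <= s by case/andP: s01.
rewrite -(legal_process_law s0 mB).
apply: le_measure; rewrite ?inE.
- exact: measurable_ysection.
- rewrite -[X in measurable X]setTI.
  exact: measurable_legal_process.
move=> y; rewrite /ysection /= inE => -[_ [Sy [n ny nc]]] /=.
rewrite /legal_process asboolT// /X (@process_in _ _ _ _ external_neq0 _ _ _ _ n)//.
by move=> f i; exact: realization_ge0.
Qed.

Lemma occursE e l c n y : S y.1 -> occurs e l c (cf y n) <->
  [&& event_type N (real y.2) y.1 n == e, t y n.+1 <= 1 & (c < jobs (current (cf y n)) l)%N].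
Proof.
move=> Sy.
have ige f i : f \in possible N -> 0 <= input (real y.2) f i.
  exact: realization_ge0.
have [_ evE _ _ _] := conf_stepP external_neq0 ige Sy n.
rewrite /occurs -[X in (X <= 1)%E]/(event_time N (real y.2) y.1 n) evE lee_fin.
split; first by move=> [<- -> ->]; rewrite eqxx.
by move=> /and3P[/eqP].
Qed.

Lemma crowded_time_le l c n y : S y.1 ->
  ((\sum_(i < n) (c < jobs (current (cf y i)) l)%N%:R
      * (Num.min (t y i.+1) 1 - Num.min (t y i) 1))%:E
   <= @lebesgue_measure R (xsection (crowded_graph l c) y))%E.
Proof.
move=> Sy.
have ige f i : f \in possible N -> 0 <= input (real y.2) f i.
  exact: realization_ge0.
have tmono i j : (i <= j)%N -> t y i <= t y j.
  exact: (time_ndecr external_neq0 ige Sy).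
pose V i : set R := if (c < jobs (current (cf y i)) l)%N
  then `[Num.min (t y i) 1, Num.min (t y i.+1) 1[%classic else set0.
have mV i : measurable (V i) by rewrite /V; case: ifP.
have VP i s : V i s -> [/\ 0 <= s < 1, t y i <= s < t y i.+1 & (c < jobs (current (cf y i)) l)%N].
  rewrite /V; case: ifP => // cj /=; rewrite in_itv /= ge_min lt_min.
  move=> /andP[/orP[ts|s1'] /andP[ts' s1]]; last by rewrite leNgt s1 in s1'.
  by rewrite s1 ts ts'; split => //; rewrite andbT (le_trans _ ts)// -[leLHS]/(t y 0) tmono.
have tV : trivIset setT V.
  apply/trivIsetP => i j _ _ /eqP ij; apply/seteqP; split => // s [/VP[_ ts _] /VP[_ ts' _]].
  by apply: ij; exact: (time_inj external_neq0 ige Sy ts ts').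
have lebE p q : p <= q -> lebesgue_measure (`[p, q[%classic : set R) = (q - p)%:E.
  rewrite lebesgue_measure_itv/= lte_fin le_eqVlt => /predU1P[->|->]; last by rewrite EFinB.
  by rewrite ltxx subrr.
have -> : (\sum_(i < n) (c < jobs (current (cf y i)) l)%N%:R
      * (Num.min (t y i.+1) 1 - Num.min (t y i) 1))%:E =
    (@lebesgue_measure R) (\big[setU/set0]_(i < n) V i).
  rewrite measure_semi_additive_ord_I; last 3 first.
  - by move=> k _; exact: mV.
  - by apply: sub_trivIset tV.
  - by apply: bigsetU_measurable => i _; exact: mV.
  rewrite -sumEFin; apply: eq_bigr => i _; rewrite /V.
  have mm : Num.min (t y i) 1 <= Num.min (t y i.+1) 1.
    by rewrite le_min !ge_min lexx tmono ?orbT.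
  case: ifP => cj; last by rewrite mul0r measure0.
  by rewrite mul1r; apply/esym; exact: lebE.
apply: lebesgue_measure_mono.
- by apply: bigsetU_measurable => i _; exact: mV.
- by apply: measurable_xsection; exact: measurable_crowded_graph.
- rewrite -bigcup_mkord => s [i _ /VP[s01 ts cj]].
  by rewrite /xsection /= inE; split => //; split => //; exists i.
Qed.

Lemma clocked_ex y : S y.1 -> ~ (forall n, t y n <= 1) ->
  exists n, clocked n 1 y.
Proof.
move=> Sy /existsNP[n /negP tn].
have ex : exists n, ~~ (t y n <= 1) by exists n.
case: (ex_minnP ex) => -[|k] tk kmin; first by rewrite ler01 in tk.
exists k; rewrite /clocked /=; apply/andP; split; last by rewrite ltNge.
by apply/negPn/negP => /kmin; rewrite ltnn.
Qed.

Local Notation Occ e l c n := [set y | occurs e l c (cf y n)].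
Local Notation sc := (scale lambda m).

(** [potential_until] at time 1, in the form that is integrated below.  The
    number k of events on the left is arbitrary, because events after time 1 do
    not count. *)
Lemma balance_path e l c w y k : e \in possible N -> (0 < w)%N ->
  S y.1 -> ~ (forall n, t y n <= 1) ->
  ((2^-1 * \sum_(i < k) \1_(long_occurs e l (c + w)%N i) y + potential e l c w (sc e) y.1)%:E
   <= (potential e l c w (sc e) (legal_process 1 y))%:E
      + ((sc e)^-1%:E * leb (xsection (crowded_graph l c) y)
      + ((e != inr l)%:R / w%:R)%:E
        * \sum_(i <oo) (\1_(Occ (inr l) l c i) y)%:E))%E.
Proof.
move=> ep w0 Sy ny.
have [n /andP[n1 n2]] := clocked_ex Sy ny.
have ige f i : f \in possible N -> 0 <= input (real y.2) f i.
  exact: realization_ge0.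
have a0 : 0 < sc e by exact: scale_gt0.
have tmono i j : (i <= j)%N -> t y i <= t y j.
  exact: (time_ndecr external_neq0 ige Sy).
have occ e' c' i := occursE e' l c' i Sy.
have half : 0 <= (2^-1 : R) <= 1 by lra.
have ns : t y n <= 1 < t y n.+1 by rewrite n1.
have := potential_until external_neq0 ige Sy e l c w0 a0 half ns.
rewrite /legal_process asboolT// /X -/(cf _ _).
set s1 := (X in 2^-1 * X + _ <= _); set s2 := (X in _ + X / _ + _).
set s3 := (X in _ + X / w%:R) => path.
have le1 : \sum_(i < k) \1_(long_occurs e l (c + w)%N i) y <= s1.
  (* Long inputs count only at events up to time 1, that is, before step n. *)
  pose b i := [&& event_type N (real y.2) y.1 i == e,
    (c + w < jobs (current (cf y i)) l)%N &
    2^-1 * sc e <= input (real y.2) e (occurred (cf y i) e)].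
  pose G i : R := ((i < n)%N && b i)%:R.
  have LG i : \1_(long_occurs e l (c + w)%N i) y <= G i.
    rewrite indicE; case: (boolP (y \in _)) => [|_]; last exact: ler0n.
    rewrite inE => -[/occ/and3P[ei ti ji] li]; rewrite ler_nat /= lt0b.
    rewrite /b ei ji input_realization mulrC ler_pM2l// li !andbT.
    rewrite ltnNge; apply/negP => ni.
    by have := lt_le_trans n2 (tmono n.+1 i.+1 ni); rewrite ltNge ti.
  apply: (@le_trans _ _ (\sum_(0 <= i < n + k) G i)).
    rewrite -(big_mkord xpredT (fun i => \1_(long_occurs e l (c + w)%N i) y)).
    rewrite (@big_cat_nat _ _ _ k 0%N (n + k))//= ?leq_addl//.
    rewrite -[leLHS]addr0; apply: lerD; first by apply: ler_sum => i _; exact: LG.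
    by apply: sumr_ge0 => i _; exact: ler0n.
  rewrite (@big_cat_nat _ _ _ n 0%N (n + k))//= ?leq_addr//.
  rewrite [X in _ + X]big_nat_cond [X in _ + X]big1 ?addr0; last first.
    by move=> i /andP[/andP[ni _] _]; rewrite /G ltnNge ni.
  by rewrite big_mkord; apply: ler_sum => i _; rewrite /G ltn_ord.
have le2 : (s2%:E <= leb (xsection (crowded_graph l c) y))%E.
  exact: crowded_time_le.
have le3 : (s3%:E <= (e != inr l)%:R%:E * \sum_(i <oo) (\1_(Occ (inr l) l c i) y)%:E)%E.
  apply: (@le_trans _ _ ((e != inr l)%:R%:E * \sum_(0 <= i < n) (\1_(Occ (inr l) l c i) y)%:E)%E).
    rewrite sumEFin -EFinM lee_fin mulr_sumr big_mkord; apply: ler_sum => i _.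
    rewrite -andbA -mulnb natrM ler_wpM2l ?ler0n// indicE ler_nat.
    case: andP => // -[/eqP fi ji]; rewrite mem_set// /mkset; apply/occ.
    by rewrite fi eqxx ji (le_trans _ n1)// tmono.
  apply: lee_wpmul2l; first by rewrite lee_fin.
  by apply: nneseries_lim_ge => i _; rewrite lee_fin.
apply: (@le_trans _ _ (2^-1 * s1 + potential e l c w (sc e) y.1)%:E).
  by rewrite lee_fin lerD2r ler_pM2l// invr_gt0.
apply: (@le_trans _ _ (potential e l c w (sc e) (process N (real y.2) y.1 1)
  + s2 / sc e + s3 / w%:R)%:E).
  by rewrite lee_fin.
rewrite -addrA 2!EFinD leeD2l//; apply: leeD.
  by rewrite mulrC EFinM lee_pmul2l// lte_fin invr_gt0.
by rewrite (mulrC s3) (mulrC (e != inr l)%:R) !EFinM -muleA lee_pmul2l// lte_fin invr_gt0 ltr0n.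
Qed.

Lemma integral_law phi (f : state R K -> R) : measurable_fun setT phi ->
  (forall B, measurable B -> mu (phi @^-1` B) = pi B) ->
  measurable_fun setT f -> (forall x, 0 <= f x) ->
  (\int[mu]_y (f (phi y))%:E = \int[pi]_x (f x)%:E)%E.
Proof.
move=> mphi law mf f0.
rewrite (eq_measure_integral (pushforward mu phi)); last by move=> A mA _; apply/esym; exact: law.
rewrite ge0_integral_pushforward//; last by move=> x _; rewrite lee_fin.
exact/measurable_EFinP.
Qed.

Lemma fst_law B : measurable B -> mu (fst @^-1` B) = pi B.
Proof.
move=> mB; rewrite -setXT; transitivity (pi B * P setT)%E.
  exact: product_measure1E.
by rewrite probability_setT mule1.
Qed.

(** The expectations of the potential at times 0 and 1 are equal and finite, so
    they cancel from the integral of [balance_path]. *)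
Lemma balance e l c w : e \in possible N -> (0 < w)%N ->
  ((2^-1)%:E * P (primitive prim e 0 @^-1` long)
     * \sum_(i <oo) mu (Occ e l (c + w)%N i)
   <= (sc e)^-1%:E * pi [set x | (c < jobs x l)%N]
      + ((e != inr l)%:R / w%:R)%:E * \sum_(i <oo) mu (Occ (inr l) l c i))%E.
Proof.
move=> ep w0.
have a0 : 0 < sc e by exact: scale_gt0.
have half : 0 <= (2^-1 : R) <= 1 by lra.
have [Z [mZ PZ ZP]] := explosion_null.
set q := P _.
have q0 : (0 <= q)%E by exact: measure_ge0.
pose pot := potential e l c w (sc e).
have mpot : measurable_fun setT pot by exact: measurable_potential.
have pot0 x : 0 <= pot x by have /andP[] := potential_bound e l c (sc e) x w0.
have pot1 x : pot x <= 1 by have /andP[] := potential_bound e l c (sc e) x w0.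
pose I := (\int[pi]_x (pot x)%:E)%E.
have Ifin : I \is a fin_num.
  rewrite ge0_fin_numE; last by apply: integral_ge0 => x _; rewrite lee_fin.
  apply: (@le_lt_trans _ _ (\int[pi]_x (cst 1 x))%E).
    apply: ge0_le_integral => //.
    - by move=> x _; rewrite lee_fin.
    - exact/measurable_EFinP.
    - by move=> x _; rewrite lee_fin.
  by rewrite integral_cst// mul1e (le_lt_trans (probability_le1 _ _))// ltry.
have mphi := measurable_legal_process 1.
have I1 : (\int[mu]_y (pot (legal_process 1 y))%:E = I)%E.
  apply: integral_law => // B mB.
  exact: (legal_process_law ler01 mB).
have I0 : (\int[mu]_y (pot y.1)%:E = I)%E.
  by apply: (@integral_law fst) => // B mB; exact: fst_law.
have mOcc e' c' i : measurable (Occ e' l c' i).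
  exact: measurable_occurs.
have mLong i : measurable (long_occurs e l (c + w)%N i).
  exact: measurable_long_occurs.
have mW := measurable_crowded_graph l c.
have finite k : ((2^-1)%:E * q * \sum_(0 <= i < k) mu (Occ e l (c + w)%N i) <= 
   (sc e)^-1%:E * pi [set x | (c < jobs x l)%N]
      + ((e != inr l)%:R / w%:R)%:E * \sum_(i <oo) mu (Occ (inr l) l c i))%E.
  pose F y := ((2^-1)%:E * (\sum_(i < k) (\1_(long_occurs e l (c + w)%N i) y)%:E) + (pot y.1)%:E)%E.
  pose G y := ((pot (legal_process 1 y))%:E
      + ((sc e)^-1%:E * leb (xsection (crowded_graph l c) y)
      + ((e != inr l)%:R / w%:R)%:E
        * \sum_(i <oo) (\1_(Occ (inr l) l c i) y)%:E))%E.
  have mind (A : set (state R K * Omega)) : measurable A ->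
      measurable_fun setT (fun y => (\1_A y)%:E : \bar R).
    by move=> mA; exact/measurable_EFinP/measurable_indic.
  have msum1 : measurable_fun setT (fun y =>
      (\sum_(i < k) (\1_(long_occurs e l (c + w)%N i) y)%:E)%E : \bar R).
    by apply: emeasurable_sum => i; exact: mind.
  have msum2 : measurable_fun setT (fun y =>
      (\sum_(i <oo) (\1_(Occ (inr l) l c i) y)%:E)%E : \bar R).
    rewrite (_ : (fun y => _) = fun y =>
      (\sum_(i <oo | i \in predT) (\1_(Occ (inr l) l c i) y)%:E)%E).
      apply: (@ge0_emeasurable_sum _ _ _ setT (fun i y => (\1_(Occ (inr l) l c i) y)%:E) predT).
        by move=> i y _ _; rewrite lee_fin.
      by move=> i _; exact: mind.
    by apply/funext => y; apply: eq_eseriesl => i; rewrite inE.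
  have mleb : measurable_fun setT (fun y => leb (xsection (crowded_graph l c) y)).
    exact: measurable_fun_xsection.
  have mpot0 : measurable_fun setT (fun y : state R K * Omega => (pot y.1)%:E).
    by apply/measurable_EFinP; exact: measurableT_comp.
  have mpot1 : measurable_fun setT (fun y => (pot (legal_process 1 y))%:E).
    by apply/measurable_EFinP; exact: measurableT_comp.
  have k0 : (0 <= ((e != inr l)%:R / w%:R)%:E :> \bar R)%E by rewrite lee_fin divr_ge0.
  have a1 : (0 <= (sc e)^-1%:E)%E by rewrite lee_fin invr_ge0 ltW.
  have S0 y : (0 <= \sum_(i <oo) (\1_(Occ (inr l) l c i) y)%:E :> \bar R)%E.
    by apply: nneseries_ge0 => i _ _; rewrite lee_fin.
  have intF : (\int[mu]_y F y = (2^-1)%:E * q * \sum_(0 <= i < k) mu (Occ e l (c + w)%N i) + I)%E.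
    rewrite /F ge0_integralD//; last 3 first.
    - by move=> y _; rewrite mule_ge0 ?lee_fin ?sume_ge0// => i _; rewrite lee_fin.
    - by apply: measurable_funeM.
    - by move=> y _; rewrite lee_fin.
    rewrite I0 ge0_integralZl//; last by move=> y _; rewrite sume_ge0// => i _; rewrite lee_fin.
    rewrite ge0_integral_sum//; last by move=> i; exact: mind.
    congr (_ + _)%E; rewrite -muleA; congr (_ * _)%E.
    rewrite big_mkord ge0_sume_distrr//; apply: eq_bigr => i _.
    rewrite integral_indic// setIT; exact: long_occurs_measure.
  have intG : (\int[mu]_y G y = I + ((sc e)^-1%:E * (mu \x leb) (crowded_graph l c)
      + ((e != inr l)%:R / w%:R)%:E * \sum_(i <oo) mu (Occ (inr l) l c i)))%E.
    rewrite /G ge0_integralD//; last 3 first.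
    - by move=> y _; rewrite lee_fin.
    - by move=> y _; rewrite adde_ge0// mule_ge0.
    - by apply: emeasurable_funD; exact: measurable_funeM.
    rewrite I1; congr (_ + _)%E; rewrite ge0_integralD//; last 4 first.
    - by move=> y _; rewrite mule_ge0.
    - exact: measurable_funeM.
    - by move=> y _; rewrite mule_ge0.
    - exact: measurable_funeM.
    rewrite !ge0_integralZl//; congr (_ + _ * _)%E.
    rewrite integral_nneseries//; last by move=> i; exact: mind.
    by apply: eq_eseriesr => i _; rewrite integral_indic// setIT.
  (* The pathwise bound fails only at illegal initial states and after an
     explosion. *)
  have FG : (\int[mu]_y F y <= \int[mu]_y G y)%E.
    apply: ae_ge0_le_integral => //.
    - move=> y _; apply: adde_ge0; last by rewrite lee_fin.
      by apply: mule_ge0; [rewrite lee_fin|apply: sume_ge0 => i _; rewrite lee_fin].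
    - by apply: emeasurable_funD => //; exact: measurable_funeM.
    - move=> y _; apply: adde_ge0; first by rewrite lee_fin.
      by apply: adde_ge0; apply: mule_ge0.
    - apply: emeasurable_funD => //.
      by apply: emeasurable_funD; exact: measurable_funeM.
    - exists (~` [set y | S y.1] `|` setT `*` Z); split.
      + apply: measurableU; last exact: measurableX.
        by apply: measurableC; exact: measurable_fst_space.
      + have mu2 : mu (setT `*` Z) = 0%E.
          transitivity (pi setT * P Z)%E; first exact: product_measure1E.
          by rewrite PZ mule0.
        apply/eqP; rewrite eq_le measure_ge0 andbT.
        apply: (@le_trans _ _ (mu (~` [set y | S y.1]) + mu (setT `*` Z))%E).
          apply: measureU2; last exact: measurableX.
          by apply: measurableC; exact: measurable_fst_space.
        by rewrite mu2 fst_space_null adde0.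
      + move=> y /= /not_implyP [_ nFG]; apply: contrapT => /not_orP [/contrapT Sy Zy].
        apply: nFG; have ny : ~ (forall n, t y n <= 1) by move=> /(ZP _ Sy) Zy2; exact: Zy.
        have := balance_path l c k ep w0 Sy ny.
        by rewrite /F /G EFinD EFinM sumEFin.
  move: FG; rewrite intF intG [leLHS]addeC leeD2lE//; move/le_trans; apply.
  rewrite leeD2r// lee_pmul2l// ?lte_fin ?invr_gt0//.
  exact: crowded_graph_measure.
have hq : ((2^-1)%:E * q)%E \is a fin_num.
  rewrite fin_numM// fin_num_measure// -[X in measurable X]setTI.
  by apply: measurable_primitive => //; exact: measurable_long.
rewrite -(fineK hq) -nneseriesZl//; apply: lime_le.
  apply: is_cvg_nneseries => i _ _; apply: mule_ge0 => //.
  by rewrite lee_fin fine_ge0// mule_ge0// lee_fin.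
apply: nearW => n; rewrite -ge0_sume_distrr; last by move=> *; exact: measure_ge0.
by rewrite fineK//; exact: finite.
Qed.

Lemma expected_events_le e l (c : nat) (thr : R) : c%:R <= thr ->
  (expected_events N prim lambda m pi e
     [set z : state R K * state R K | (thr < (jobs z.1 l)%:R)%R]
   <= \sum_(i <oo) mu (Occ e l c i))%E.
Proof.
move=> cthr.
have mOcc i : measurable (Occ e l c i) by exact: measurable_occurs.
have -> : (\sum_(i <oo) mu (Occ e l c i) =
    \int[mu]_y \sum_(i <oo) (\1_(Occ e l c i) y)%:E)%E.
  rewrite integral_nneseries//.
    by apply: eq_eseriesr => i _; rewrite integral_indic// setIT.
  by move=> i; exact/measurable_EFinP/measurable_indic.
apply: (@le_integral_on _ _ _ _ setT) => //.
- by rewrite setCT measure0.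
- by move=> y; apply: nneseries_ge0 => n _ _; rewrite lee_fin.
- by move=> y; apply: nneseries_ge0 => n _ _; rewrite lee_fin.
move=> y _; apply: lee_nneseries => [i _ _|i _]; first by rewrite lee_fin.
rewrite lee_fin !indicE ler_nat; case: (boolP (y \in _)) => //.
rewrite inE => -[/andP[_ t1] te lz]; rewrite mem_set//; split => //.
rewrite -(ltr_nat R); apply: le_lt_trans cthr _.
by move: lz; rewrite /= /pre_state /settle; case: ifP.
Qed.

Lemma long_fin e : P (primitive prim e 0 @^-1` long) \is a fin_num.
Proof.
rewrite fin_num_measure// -[X in measurable X]setTI.
by apply: measurable_primitive => //; exact: measurable_long.
Qed.

Local Notation tail e := (fine (P (primitive prim e 0 @^-1` long))).

Lemma tail_gt0 e : e \in possible N -> 0 < tail e.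
Proof. by move=> ep; rewrite -lte_fin fineK ?long_fin// primitive_tail. Qed.

Lemma balance_real e l c w : e \in possible N -> (0 < w)%N ->
  (\sum_(i <oo) mu (Occ e l (c + w)%N i) <= (2 / tail e)%:E *
     ((sc e)^-1%:E * pi [set x | (c < jobs x l)%N]
      + ((e != inr l)%:R / w%:R)%:E * \sum_(i <oo) mu (Occ (inr l) l c i)))%E.
Proof.
move=> ep w0; have := balance l c ep w0.
rewrite -(fineK (long_fin e)) -EFinM => h.
have t0 := tail_gt0 ep.
rewrite -lee_pdivrMl ?divr_gt0// invf_div mulrC; exact: h.
Qed.

(** [balance] twice: first for class l completions with a ramp of width 1, then
    for e. *)
Lemma occurs_bound e l c w : e \in possible N -> (0 < w)%N ->
  (\sum_(i <oo) mu (Occ e l (c.+1 + w)%N i) <=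
   (2 / tail e * ((sc e)^-1 + 2 / (tail (inr l) * m l 0 * w%:R)))%:E
     * pi [set x | (c < jobs x l)%N])%E.
Proof.
move=> ep w0.
have lp : inr l \in possible N by rewrite inE.
have tl := tail_gt0 lp; have te := tail_gt0 ep.
have a0 : 0 < sc e by exact: scale_gt0.
have mB k : measurable [set x : state R K | (k < jobs x l)%N].
  by have := @measurable_jobs R K l measurableT [set z | (k < z)%N] I; rewrite setTI.
have mono : (pi [set x | (c.+1 < jobs x l)%N] <= pi [set x | (c < jobs x l)%N])%E.
  by apply: le_measure; rewrite ?inE// => x /=; exact: ltnW.
have := balance_real l c lp (ltn0Sn 0); rewrite addn1 eqxx mul0r mul0e adde0 => low.
apply: le_trans (balance_real l c.+1 ep w0) _.
rewrite [X in (_ <= X * _)%E]EFinM -muleA lee_pmul2l// ?lte_fin ?divr_gt0//.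
rewrite EFinD ge0_muleDl ?lee_fin ?invr_ge0 ?divr_ge0 ?mulr_ge0 ?ler0n
  ?(ltW a0) ?(ltW tl) ?(ltW (m_gt0 _))//.
apply: leeD; first by rewrite lee_pmul2l// lte_fin invr_gt0.
apply: (@le_trans _ _ ((w%:R^-1)%:E * \sum_(i <oo) mu (Occ (inr l) l c.+1 i))%E).
  apply: lee_wpmul2r; first by apply: nneseries_ge0 => i _ _; exact: measure_ge0.
  by rewrite lee_fin ler_piMl ?invr_ge0// lern1; case: (_ != _).
apply: (@le_trans _ _ ((w%:R^-1)%:E * ((2 / tail (inr l))%:E *
   ((m l 0)^-1%:E * pi [set x | (c < jobs x l)%N])))%E).
  by rewrite lee_pmul2l// lte_fin invr_gt0 ltr0n.
rewrite 2!muleA -!EFinM le_eqVlt; apply/orP; left; apply/eqP; congr (_%:E * _)%E.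
by rewrite !invfM; ring.
Qed.

End stationary_network.

(** * Asymptotics in r *)

Section asymptotics.
Variables (R : realType) (K : nat).

Lemma little_o_rP (f g : R -> \bar R) (C : R) : 0 < C ->
  (\forall r \near 0^'+, (0 <= f r)%E /\ (f r <= C%:E * g r)%E) ->
  (forall eps, 0 < eps -> \forall r \near 0^'+, (g r <= (eps * r)%:E)%E) ->
  little_o_r f.
Proof.
move=> C0 fg gs.
have bound eps : 0 < eps -> \forall r \near 0^'+,
    0 < r /\ (0 <= f r)%E /\ (f r <= (eps * r)%:E)%E.
  move=> eps0; have eC : 0 < eps / C by rewrite divr_gt0.
  near=> r; split; first by near: r; exact: nbhs_right_gt.
  have [f0 fr] : (0 <= f r)%E /\ (f r <= C%:E * g r)%E by near: r.
  split => //; apply: le_trans fr _.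
  have gr : (g r <= (eps / C * r)%:E)%E by near: r; exact: gs.
  rewrite (_ : eps * r = C * (eps / C * r)); last by field; rewrite gt_eqF.
  by rewrite EFinM lee_pmul2l.
split.
  near=> r; have [r0 [f0 fr]] : 0 < r /\ (0 <= f r)%E /\ (f r <= (1 * r)%:E)%E.
    by near: r; exact: bound.
  by rewrite ge0_fin_numE// (le_lt_trans fr)// ltry.
apply/eqoP => eps eps0; near=> r.
have [r0 [f0 fr]] : 0 < r /\ (0 <= f r)%E /\ (f r <= (eps * r)%:E)%E.
  by near: r; exact: bound.
have ffin : f r \is a fin_num by rewrite ge0_fin_numE// (le_lt_trans fr)// ltry.
by rewrite ger0_norm ?fine_ge0// gtr0_norm// -lee_fin fineK.
Unshelve. all: by end_near. Qed.

Lemma tail_markov (pi : probability (state R K) R) l (n : nat) (c eps : R) :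
  c < n.+1%:R ->
  (\int[pi]_(x in [set x : state R K | (c < `|(jobs x l)%:R|)%R]) `|(jobs x l)%:R|%:E
    <= eps%:E)%E ->
  (n.+1%:R%:E * pi [set x | (n < jobs x l)%N] <= eps%:E)%E.
Proof.
move=> cn; apply: le_trans.
have mZ : measurable_fun setT (fun x : state R K => `|(jobs x l)%:R| : R).
  apply: (measurableT_comp (f := fun z : nat => `|z%:R| : R)) => //.
  exact: measurable_jobs.
have mB : measurable [set x : state R K | (n < jobs x l)%N].
  by have := @measurable_jobs R K l measurableT [set z | (n < z)%N] I; rewrite setTI.
have mC : measurable [set x : state R K | (c < `|(jobs x l)%:R|)%R].
  by apply: measurable_true; apply: measurable_fun_ltr.
apply: (@le_trans _ _
  (\int[pi]_(x in [set x : state R K | (n < jobs x l)%N]) `|(jobs x l)%:R|%:E)%E);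
  last first.
  apply: ge0_subset_integral => //.
  - by apply/measurable_EFinP; exact: measurable_funTS.
  - by move=> x /= nx; apply: lt_le_trans cn _; rewrite ger0_norm// ler_nat.
rewrite -(integral_cst pi mB); apply: ge0_le_integral => //.
- by move=> x _; rewrite lee_fin.
- by apply/measurable_EFinP; exact: measurable_funTS.
- by move=> x /= nx; rewrite lee_fin ger0_norm// ler_nat.
Qed.

Lemma ui_tail (pi : R -> probability (state R K) R) l :
  uniformly_integrable pi (fun x => (jobs x l)%:R) -> forall eps, 0 < eps ->
  \forall r \near 0^'+,
    (pi r [set x | (Num.truncn (4 * r)^-1 < jobs x l)%N] <= (eps * r)%:E)%E.
Proof.
move=> ui eps eps0; have e4 : 0 < eps / 4 by rewrite divr_gt0.
have [c cP] := ui _ e4.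
near=> r; have r0 : 0 < r by near: r; exact: nbhs_right_gt.
have r1 : r <= 1 by near: r; exact: nbhs_right_le.
have rc : r < (4 * (`|c| + 1))^-1.
  by near: r; apply: nbhs_right_lt; rewrite invr_gt0 mulr_gt0// ltr_wpDl.
have wr : (4 * r)^-1 < (Num.truncn (4 * r)^-1).+1%:R by exact: truncnS_gt.
have cr : c < (Num.truncn (4 * r)^-1).+1%:R.
  apply: lt_trans wr; apply: le_lt_trans (ler_norm c) _.
  move: rc; rewrite -[ltRHS]mul1r ltr_pdivlMr ?mulr_gt0 ?ltr_wpDl// => rc.
  by rewrite -[ltRHS]mul1r ltr_pdivlMr ?mulr_gt0//; lra.
have r01 : 0 < r <= 1 by rewrite r0.
have mul : ((4 * r)^-1%:E * pi r [set x | (Num.truncn (4 * r)^-1 < jobs x l)%N]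
    <= (eps / 4)%:E)%E.
  apply: le_trans (tail_markov cr (cP r r01)).
  by apply: lee_wpmul2r; [exact: measure_ge0|rewrite lee_fin ltW].
move: mul; rewrite lee_pdivrMl ?mulr_gt0// -EFinM.
by rewrite (_ : 4 * r * (eps / 4) = eps * r)//; field.
Unshelve. all: by end_near. Qed.

End asymptotics.

Section heavy_traffic_family.
Variables (R : realType) (J K : nat) (N : network J K).
Variables (d : measure_display) (Omega : measurableType d) (P : probability Omega R).
Variable prim : primitives P K.

Lemma total_rate_at (lambda lambdas : 'cV[R]_K) r k :
  total_rate prim (at_param lambda lambdas r) k 0 =
  (1 - r) * total_rate prim lambda k 0
  + r * total_rate prim (at_param lambda lambdas 1) k 0.
Proof.
rewrite /total_rate /at_param !mulmxBr -!scalemxAr !mxE; ring.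
Qed.

Lemma at_paramE (v vs : 'cV[R]_K) r k :
  at_param v vs r k 0 = (1 - r) * v k 0 + r * at_param v vs 1 k 0.
Proof. by rewrite /at_param !mxE; ring. Qed.

(** Parameters that are affine in r stay away from 0 for small r if they are
    positive at r = 0 and at r = 1. *)
Lemma half_le (x y r : R) : 0 < x -> 0 < y -> 0 < r <= 2^-1 ->
  x / 2 <= (1 - r) * x + r * y.
Proof.
move=> x0 y0 /andP[r0 r1]; have : 0 <= r * y by rewrite mulr_ge0// ltW.
have : 0 <= (2^-1 - r) * x by rewrite mulr_ge0 ?subr_ge0// ltW.
lra.
Qed.

Lemma external_nonempty (lambda lambdas m ms : 'cV[R]_K) (l : 'I_K) :
  heavy_traffic N prim lambda lambdas m ms -> 0 < total_rate prim lambda l 0 ->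
  external N != finset.set0.
Proof.
move=> hA2 al; apply/eqP => ext0; move: al; rewrite (_ : lambda = 0).
  by rewrite /total_rate mulmx0 mxE ltxx.
apply/colP => k; have kN : k \notin external N by rewrite ext0 inE.
by rewrite mxE (lambda_eq0 hA2 kN).1.
Qed.

(** The ramp used at parameter r climbs from [w + 1] to [2 w + 1], where
    [w = Num.truncn (4 * r)^-1]. *)
Lemma window_bounds (r : R) : 0 < r <= 8^-1 -> let w := Num.truncn (4 * r)^-1 in
  [/\ (0 < w)%N, (8 * r)^-1 <= w%:R & (w.+1 + w)%:R <= r^-1 - 1].
Proof.
move=> /andP[r0 r8] w.
have i4 : 2 * (8 * r)^-1 = (4 * r)^-1 by field; rewrite gt_eqF.
have ir : 4 * (4 * r)^-1 = r^-1 by field; rewrite gt_eqF.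
have i8 : 1 <= (8 * r)^-1.
  have r81 : 8 * r <= 1 by lra.
  by rewrite -[leLHS]invr1 lef_pV2 ?posrE ?mulr_gt0.
have wl : w%:R <= (4 * r)^-1 by rewrite truncn_le// invr_ge0 mulr_ge0// ltW.
have wu : (4 * r)^-1 < w%:R + 1 by rewrite natr1; exact: truncnS_gt.
have w8 : (8 * r)^-1 <= w%:R.
  by move: i4 i8 wu; move: (w%:R) (_^-1) (_^-1) => ? ? ? *; lra.
split => //; first by rewrite -(ltr_nat R); exact: lt_le_trans ltr01 (le_trans i8 w8).
rewrite natrD -natr1; move: i4 ir i8 wl wu; move: (w%:R) (_^-1) (_^-1) (_^-1) => ? ? ? ? *; lra.
Qed.

(** [w * L] stays bounded below even if the arrival rate L is of order r. *)
Lemma arrival_constant (te tl mr w L M D : R) :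
  0 < te -> 0 < tl -> 0 < M <= mr -> 0 < D <= w * L -> 0 < L -> 0 < w ->
  L^-1 * (2 / te * (L + 2 / (tl * mr * w))) <= 2 / te * (1 + 2 / (tl * M * D)).
Proof.
move=> te0 tl0 /andP[M0 Mmr] /andP[D0 DwL] L0 w0; have mr0 := lt_le_trans M0 Mmr.
have -> : L^-1 * (2 / te * (L + 2 / (tl * mr * w))) =
    2 / te * (1 + 2 / (tl * mr * (w * L))) by field; rewrite !gt_eqF.
rewrite ler_pM2l ?divr_gt0// lerD2l ler_pM2l// lef_pV2 ?qualifE/= ?mulr_gt0//.
by apply: ler_pM => //; rewrite ?mulr_ge0 ?(ltW tl0) ?(ltW M0) ?(ltW D0)// ler_pM2l.
Qed.

Lemma service_constant (te tl mk mr w A A' M M' : R) :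
  0 < te -> 0 < tl -> 0 < M <= mr -> 0 < M' <= mk -> 0 < A' <= A -> 1 <= w ->
  A^-1 * (2 / te * (mk^-1 + 2 / (tl * mr * w))) <=
  A'^-1 * (2 / te * (M'^-1 + 2 / (tl * M))).
Proof.
move=> te0 tl0 /andP[M0 Mmr] /andP[M'0 Mmk] /andP[A0 AA] w1.
have mr0 := lt_le_trans M0 Mmr; have mk0 := lt_le_trans M'0 Mmk.
have AA0 := lt_le_trans A0 AA; have w0 : 0 < w by exact: lt_le_trans w1.
apply: ler_pM.
- by rewrite invr_ge0 ltW.
- by rewrite mulr_ge0 ?addr_ge0 ?divr_ge0 ?invr_ge0 ?mulr_ge0 ?ltW.
- by rewrite lef_pV2.
rewrite ler_pM2l ?divr_gt0//; apply: lerD; first by rewrite lef_pV2.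
rewrite ler_pM2l// lef_pV2 ?qualifE/= ?mulr_gt0//.
apply: (@le_trans _ _ (tl * mr)); first by rewrite ler_pM2l.
by rewrite ler_peMr// mulr_ge0// ltW.
Qed.

End heavy_traffic_family.

Theorem lemma8p4 (R : realType) (J K : nat) (hJK : (J < K)%N)
    (N : network J K)
    (d : measure_display) (Omega : measurableType d) (P : probability Omega R)
    (prim : primitives P K) (hprim : primitives_assumption N prim)
    (hrouting : (1%:M - routing_matrix prim) \in unitmx)
    (lambda lambdas m ms : 'cV[R]_K)
    (pi : R -> probability (state R K) R)
    (halpha : forall k, 0 < total_rate prim lambda k 0)
    (halphar : forall r : R, 0 < r <= 1 ->
       forall k, 0 < total_rate prim (at_param lambda lambdas r) k 0)
    (hA1 : moment_assumption N prim)
    (hA2 : heavy_traffic N prim lambda lambdas m ms)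
    (hA3 : stability N prim lambda lambdas m ms pi)
    (hA4 : state_space_collapse N pi)
    (l : 'I_K) (hl : high_priority N l) :
  let large (r : R) : set (state R K * state R K) :=
    [set y | r^-1 - 1 < (jobs y.1 l)%:R] in
  (forall k, k \in external N ->
     little_o_r (fun r => palm_e N prim (at_param lambda lambdas r)
                            (at_param m ms r) (pi r) k (large r))) /\
  (forall k,
     little_o_r (fun r => palm_s N prim (at_param lambda lambdas r)
                            (at_param m ms r) (pi r) k (large r))).
Proof.
move=> large.
have ext0 := external_nonempty hA2 (halpha l).
pose w (r : R) := Num.truncn (4 * r)^-1.
pose g r := pi r [set x | (w r < jobs x l)%N].
have gs := ui_tail (hA4 l hl).
pose lam r := at_param lambda lambdas r; pose mu r := at_param m ms r.
pose tail e := fine (P (primitive prim e 0 @^-1` (@long R))).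
have tail0 e : e \in possible N -> 0 < tail e by exact: (tail_gt0 hprim).
have tl : 0 < tail (inr l) by apply: tail0; rewrite inE.
have r18 : 0 < (8^-1 : R) by rewrite invr_gt0.
have one : 0 < (1 : R) <= 1 by rewrite ltr01 lexx.
have mu_ge r k : 0 < r <= 8^-1 -> m k 0 / 2 <= mu r k 0.
  move=> /andP[r0 r8]; rewrite /mu at_paramE; apply: half_le.
  - exact: (m_gt0 hA2).
  - exact: (mr_gt0 hA2 one).
  - by rewrite r0; lra.
have m2 k : 0 < m k 0 / 2 by rewrite divr_gt0// (m_gt0 hA2).
have ev_bound r e : 0 < r <= 8^-1 -> e \in possible N ->
    (expected_events N prim (lam r) (mu r) (pi r) e (large r) <=
     (2 / tail e * ((scale (lam r) (mu r) e)^-1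
        + 2 / (tail (inr l) * mu r l 0 * (w r)%:R)))%:E * g r)%E.
  move=> r8 ep; have [w0 _ thr] := window_bounds r8.
  have r01 : 0 < r <= 1 by case/andP: r8 => r0 r8; rewrite r0; lra.
  apply: le_trans (expected_events_le hprim _ _ _ _ _ thr) _.
  exact: (occurs_bound hprim (lambdar_gt0 hA2 r01) (mr_gt0 hA2 r01) ext0
    (hA3 r r01).1 l (w r) ep w0).
have near8 : \forall r \near (0 : R)^'+, 0 < r <= 8^-1.
  near=> r; apply/andP; split; first by near: r; exact: nbhs_right_gt.
  by near: r; exact: nbhs_right_le.
have small (rho : R -> R) (C : R) e : e \in possible N -> 0 < C ->
    (forall r, 0 < r <= 8^-1 -> 0 < rho r /\
      (rho r)^-1 * (2 / tail e * ((scale (lam r) (mu r) e)^-1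
        + 2 / (tail (inr l) * mu r l 0 * (w r)%:R))) <= C) ->
    little_o_r (fun r => ((rho r)^-1%:E *
      expected_events N prim (lam r) (mu r) (pi r) e (large r))%E).
  move=> ep C0 rhoC; apply: (little_o_rP C0 _ gs).
  near=> r; have r8 : 0 < r <= 8^-1 by near: r.
  have [rho0 rC] := rhoC r r8.
  split.
    apply: mule_ge0; first by rewrite lee_fin invr_ge0 ltW.
    apply: integral_ge0 => y _; apply: nneseries_ge0 => n _ _; rewrite lee_fin.
    by rewrite indicE ler0n.
  apply: (@le_trans _ _ ((rho r)^-1%:E * ((2 / tail e * ((scale (lam r) (mu r) e)^-1
        + 2 / (tail (inr l) * mu r l 0 * (w r)%:R)))%:E * g r))%E).
    by rewrite lee_pmul2l// ?lte_fin ?invr_gt0//; exact: ev_bound.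
  by rewrite muleA -EFinM; apply: lee_wpmul2r; rewrite ?lee_fin// measure_ge0.
split => k => [kE|].
- have gap : 0 < lambda k 0 - lambdas k 0.
    by have := lambdar_gt0 hA2 one kE; rewrite !mxE mul1r.
  have ep : (inl k : event K) \in possible N by rewrite inE.
  apply: (small (fun r => lam r k 0)
     (2 / tail (inl k) * (1 + 2 / (tail (inr l) * (m l 0 / 2)
        * ((lambda k 0 - lambdas k 0) / 8))))) => //.
    rewrite mulr_gt0 ?divr_gt0 ?tail0// addr_gt0// divr_gt0//.
    by rewrite !mulr_gt0 ?divr_gt0 ?invr_gt0// (m_gt0 hA2).
  move=> r r8; have [w0 w8 _] := window_bounds r8.
  have r01 : 0 < r <= 1 by case/andP: r8 => r0 r8; rewrite r0; lra.
  have L0 : 0 < lam r k 0 := lambdar_gt0 hA2 r01 kE.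
  split => //=; rewrite invrK; apply: arrival_constant => //.
  - exact: tail0.
  - by rewrite m2 mu_ge.
  - rewrite divr_gt0//=; apply: (@le_trans _ _ ((8 * r)^-1 * lam r k 0)).
      (* By linearity and lambda >= 0, the rate at r is at least r times the rate at 1. *)
      have -> : (lambda k 0 - lambdas k 0) / 8 = (8 * r)^-1 * (r * (lambda k 0 - lambdas k 0)).
        by field; case/andP: r8 => r0 _; rewrite gt_eqF.
      case/andP: r01 => r0 r1; rewrite ler_pM2l ?invr_gt0 ?mulr_gt0// /lam at_paramE.
      rewrite !mxE mul1r lerDr mulr_ge0 ?subr_ge0//; exact: (lambda_ge0 hA2).
    by rewrite ler_pM2r.
  - by rewrite ltr0n.
- have ep : (inr k : event K) \in possible N by rewrite inE.
  have a2 : 0 < total_rate prim lambda k 0 / 2 by rewrite divr_gt0.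
  apply: (small (fun r => total_rate prim (lam r) k 0)
     ((total_rate prim lambda k 0 / 2)^-1 * (2 / tail (inr k)
        * ((m k 0 / 2)^-1 + 2 / (tail (inr l) * (m l 0 / 2)))))) => //.
    rewrite mulr_gt0 ?invr_gt0// mulr_gt0 ?divr_gt0 ?tail0//.
    by rewrite addr_gt0 ?invr_gt0 ?divr_gt0 ?mulr_gt0 ?divr_gt0// (m_gt0 hA2).
  move=> r r8; have [w0 w8 _] := window_bounds r8.
  have r01 : 0 < r <= 1 by case/andP: r8 => r0 r8; rewrite r0; lra.
  split; first exact: halphar.
  apply: service_constant => //.
  - exact: tail0.
  - by rewrite m2 mu_ge.
  - by rewrite m2 mu_ge.
  - rewrite a2 /lam total_rate_at half_le// ?halphar//.
    by case/andP: r8 => r0 r8; rewrite r0; lra.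
  - by rewrite ler1n.
Unshelve. all: by end_near. Qed.
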